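(* Let $h:\mathbb{R}\to\mathbb{R}$ satisfy: (1) $h$ is even; (2) $h\in C^2$ and $h(0)=h'(0)=h''(0)=0$; (3) $h''$ is strictly increasing, unbounded and concave on $[0,\infty)$. Then in the game UFQSH with parameter $h$, Skeptic can force the event $$\left(A_n\to\infty\ \text{ and }\ \sum_n\frac{w_n}{h(b_n)}<\infty\right)\ \Longrightarrow\ \limsup_{n\to\infty}\frac{S_n-\sum_{i=1}^n m_i}{\sqrt{2A_n\ln\ln A_n}}=1,$$ where $A_n=\sum_{i=1}^n v_i$, $S_n=\sum_{i=1}^n x_i$ and $b_n=\sqrt{A_n/\ln\ln A_n}$.
   Context: UFQSH (Unbounded Forecasting Game with Quadratic and Stronger Hedges) with parameter $h:\mathbb{R}\to\mathbb{R}$ is the following perfect-information game between Forecaster, Skeptic and Reality. Put $\mathcal{K}_0:=1$. In each round $n=1,2,\ldots$: Forecaster announces $m_n\in\mathbb{R}$, $v_n\ge 0$, $w_n\ge 0$; then Skeptic announces $M_n,V_n,W_n\in\mathbb{R}$; then Reality announces $x_n\in\mathbb{R}$; and Skeptic's capital is updated by $$\mathcal{K}_n:=\mathcal{K}_{n-1}+M_n(x_n-m_n)+V_n\big((x_n-m_n)^2-v_n\big)+W_n\big(h(x_n-m_n)-w_n\big).$$ Collateral duties: Skeptic must keep $\mathcal{K}_n$ non-negative; Reality must keep $\mathcal{K}_n$ from tending to infinity; Forecaster must keep the game coherent. The game is coherent if Reality can make the capital not increase at any round, i.e. for every $n$ and every $(M,V,W)\in\mathbb{R}^3$ there is $x\in\mathbb{R}$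 with $M(x-m_n)+V((x-m_n)^2-v_n)+W(h(x-m_n)-w_n)\le 0$. An event is a property of the infinite sequence of moves of Forecaster and Reality. A strategy for Skeptic chooses $(M_n,V_n,W_n)$ as a function of all moves made before it (including Forecaster's $n$-th announcement). Skeptic can force an event $E$ if he has a strategy such that, whatever Reality does and whatever Forecaster does subject to his collateral duty (coherence), $\mathcal{K}_n\ge 0$ for all $n$, and either $E$ happens or $\mathcal{K}_n\to\infty$. Convention: expressions involving $\ln\ln A_n$ (including the terms of $\sum_n w_n/h(b_n)$) are considered only for those $n$ with $A_n>e$, which excludes only finitely many $n$ when $A_n\to\infty$. *)

(* Defs.v *)
From Stdlib Require Import Reals List.
From Coquelicot Require Import Coquelicot.
Open Scope R_scope.

(* Classical real numbers of the standard library, with Coquelicot limits.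
   Rounds are numbered from 0: index [n] of a sequence of moves, and of the
   partial sums [A_seq], [S_seq], [b_seq] below, is round n+1 of the game.
   Only [capital] counts completed rounds, so that [capital h p 0] is K_0. *)

Record forecast := Forecast { fc_m : R; fc_v : R; fc_w : R }.

Record bet := Bet { bet_M : R; bet_V : R; bet_W : R }.

Record round := Round { rd_forecast : forecast; rd_bet : bet; rd_x : R }.

Definition gain (h : R -> R) (f : forecast) (b : bet) (x : R) : R :=
  bet_M b * (x - fc_m f)
  + bet_V b * ((x - fc_m f) ^ 2 - fc_v f)
  + bet_W b * (h (x - fc_m f) - fc_w f).

Definition legal (f : forecast) : Prop := 0 <= fc_v f /\ 0 <= fc_w f.

Definition coherent (h : R -> R) (f : forecast) : Prop :=
  forall b : bet, exists x : R, gain h f b x <= 0.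

Definition play := nat -> round.

Definition forecasts (p : play) : nat -> forecast := fun n => rd_forecast (p n).

Definition outcomes (p : play) : nat -> R := fun n => rd_x (p n).

Definition history (p : play) (n : nat) : list round :=
  List.map p (List.seq 0 n).

Fixpoint capital (h : R -> R) (p : play) (n : nat) : R :=
  match n with
  | O => 1
  | S k => capital h p k
           + gain h (rd_forecast (p k)) (rd_bet (p k)) (rd_x (p k))
  end.

Definition strategy := list round -> forecast -> bet.

Definition follows (s : strategy) (p : play) : Prop :=
  forall n : nat, rd_bet (p n) = s (history p n) (rd_forecast (p n)).

Definition event := (nat -> forecast) -> (nat -> R) -> Prop.

Definition can_force (h : R -> R) (E : event) : Prop :=
  exists s : strategy,
    forall p : play,
      follows s p ->
      (forall n, legal (forecasts p n)) ->
      (forall n, coherent h (forecasts p n)) ->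
      (forall n, 0 <= capital h p n) /\
      (E (forecasts p) (outcomes p) \/ is_lim_seq (capital h p) p_infty).

(* In Coquelicot [ex_derive_n h 2] does not imply [ex_derive h], so both
   derivatives are required to exist explicitly. *)
Definition C2 (h : R -> R) : Prop :=
  (forall x, ex_derive h x) /\
  (forall x, ex_derive (Derive h) x) /\
  (forall x, continuous (Derive_n h 2) x).

Definition strictly_increasing_nonneg (g : R -> R) : Prop :=
  forall x y, 0 <= x -> x < y -> g x < g y.

Definition unbounded_nonneg (g : R -> R) : Prop :=
  forall B, exists x, 0 <= x /\ B < Rabs (g x).

Definition concave_nonneg (g : R -> R) : Prop :=
  forall x y t, 0 <= x -> 0 <= y -> 0 <= t <= 1 ->
    t * g x + (1 - t) * g y <= g (t * x + (1 - t) * y).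

Definition A_seq (f : nat -> forecast) (n : nat) : R :=
  sum_f_R0 (fun i => fc_v (f i)) n.

Definition S_seq (x : nat -> R) (n : nat) : R := sum_f_R0 x n.

Definition b_seq (f : nat -> forecast) (n : nat) : R :=
  sqrt (A_seq f n / ln (ln (A_seq f n))).

(* The series ranges over the rounds with A_n > e only: for the others
   ln (ln A_n) is not a positive real number. *)
Definition w_term (h : R -> R) (f : nat -> forecast) (n : nat) : R :=
  if Rlt_dec (exp 1) (A_seq f n) then fc_w (f n) / h (b_seq f n) else 0.

(* Used only when A_n tends to infinity; the finitely many n with A_n <= e
   then do not affect the limit superior. *)
Definition lil_ratio (f : nat -> forecast) (x : nat -> R) (n : nat) : R :=
  (S_seq x n - sum_f_R0 (fun i => fc_m (f i)) n)
  / sqrt (2 * A_seq f n * ln (ln (A_seq f n))).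

(* Main.v *)
Require Import Defs.
From Stdlib Require Import ZArith Reals List Lra Lia ClassicalEpsilon.
From Coquelicot Require Import Coquelicot.
Open Scope R_scope.

(** Write y_n = x_n - m_n for the deviations. The proof is a game version of
    Kolmogorov's law of the iterated logarithm in which h serves as an exact
    budget for all third-order errors.

    The hypotheses on h say that h grows at least quadratically and at most
    cubically, in the sense of ratios ([hedge]). Buying 1/h(b_n) units of the
    h-ticket per unit of capital multiplies the capital by about
    1 + h(y_n)/h(b_n) - w_n/h(b_n), so if the prices w_n/h(b_n) are summable then
    either the capital is unbounded or the sum of h(y_n)/h(b_n) converges
    ([hedge_forces_summability]). Because h is at most cubic, the convergent
    series dominates (|y_n|/b_n)^3, hence y_n = o(b_n); coherence bounds v_n by
    w_n in the same way ([coherent_hedge_bound]). For lambda of order 1/b_n the bet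
    1 + lambda y + lambda^2 (y^2 - v)/2 then equals exp(lambda y - lambda^2 v/2)
    up to a factor whose logarithm is summable ([tilt_factor_bounds]), so that the
    exponential martingales of the classical proof are available to Skeptic.

    Upper bound ([upper_bound]). Mix the exponential martingales with
    lambda_k = sqrt (2 lnln B_k / B_k), B_k = (1+eps)^k, with weights of order
    k^(-1-eps/2). If the sum of deviations exceeds (1+eps) sqrt (2 A lnln A) while A
    is in block k, the k-th one is of order at least k^(1+eps). Applied to -y this
    also gives a crude lower bound for the sum of deviations.

    Lower bound ([lower_bound]). Cut time into blocks A in [rho^k, rho^(k+1)) with
    rho large. In each block Skeptic sells short 1/(2(k+1)) of an exponential
    martingale L with a steep lambda, started at 1. If the sum of deviations stays
    below (1-eps) sqrt (2 A lnln A), completing the square shows that L stays below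
    k+1 throughout the block ([exponent_within_block]), and the steepness drives L
    below 1/2 by its end ([exponent_end_of_block]); up to summable errors each block
    multiplies the capital by 1 + 1/(4(k+1)), and these factors have a divergent
    product. A short seller is exposed to one wild outcome: a multiple of 1/h(b_n) of
    h-tickets, whose value grows at least quadratically, covers the loss, and their
    total price is again a convergent series.

    All these martingales are mixed into one, with countably many weights. The
    stakes of each are bounded by its capital, which makes the mixture converge on
    every path. Finally, banking one unit each time the active capital doubles
    turns an unbounded capital into one that tends to infinity
    ([force_of_martingale]). *)

(** * Growth of the hedge *)

Lemma le_div a b c : 0 < c -> a * c <= b -> a <= b / c.
Proof. intros Hc. apply (Rle_div_r a b c), Hc. Qed.

Lemma mult_le_of_le_div a b c : 0 < c -> a <= b / c -> a * c <= b.
Proof. intros Hc. apply (Rle_div_r a b c), Hc. Qed.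

Lemma div_le a b c : 0 < c -> a <= b * c -> a / c <= b.
Proof. intros Hc. apply (Rle_div_l a b c), Hc. Qed.

Lemma le_mult_of_div_le a b c : 0 < c -> a / c <= b -> a <= b * c.
Proof. intros Hc. apply (Rle_div_l a b c), Hc. Qed.

(** h(x)/x^2 increases and h(x)/x^3 decreases on the positive axis, written without
    division. The quadratic side lets the hedge pay for the y^2 part of a bet at
    large deviations; the cubic side lets it pay for third-order Taylor remainders
    at small ones. *)
Record hedge (h : R -> R) : Prop := Hedge {
  hedge_even : forall x, h (- x) = h x;
  hedge_zero : h 0 = 0;
  hedge_pos : forall x, 0 < x -> 0 < h x;
  hedge_cubic : forall t x, 0 <= t <= 1 -> 0 <= x -> t ^ 3 * h x <= h (t * x);
  hedge_quadratic : forall t x, 0 <= t <= 1 -> 0 <= x -> h (t * x) <= t ^ 2 * h x }.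

Lemma nonneg_of_derive_nonneg (g g' : R -> R) :
  (forall x, is_derive g x (g' x)) -> g 0 = 0 ->
  (forall x, 0 <= x -> 0 <= g' x) -> forall x, 0 <= x -> 0 <= g x.
Proof.
  intros Hd H0 Hp x Hx.
  destruct (MVT_gen g 0 x g') as [c [Hc E]].
  - intros; apply Hd.
  - intros y _. apply derivable_continuous_pt. exists (g' y). apply is_derive_Reals, Hd.
  - rewrite H0 in E. rewrite Rmin_left in Hc by lra. rewrite Rmax_right in Hc by lra.
    assert (0 <= g' c) by (apply Hp; lra). nra.
Qed.

Lemma pos_of_derive_pos (g g' : R -> R) :
  (forall x, is_derive g x (g' x)) -> g 0 = 0 ->
  (forall x, 0 < x -> 0 < g' x) -> forall x, 0 < x -> 0 < g x.
Proof.
  intros Hd H0 Hp x Hx.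
  destruct (MVT_cor2 g g' 0 x Hx) as [c [E Hc]].
  - intros; apply is_derive_Reals, Hd.
  - rewrite H0 in E. assert (0 < g' c) by (apply Hp; lra). nra.
Qed.

(** The differences of the two sides vanish at 0 with their first derivatives, and the
    second derivatives compare: concavity and h''(0) = 0 give t h''(x) <= h''(t x), monotonicity
    gives h''(t x) <= h''(x). Integrate twice. *)
Lemma hedge_of_C2 (h : R -> R) :
  (forall x, h (- x) = h x) -> C2 h -> h 0 = 0 -> Derive h 0 = 0 ->
  Derive_n h 2 0 = 0 -> strictly_increasing_nonneg (Derive_n h 2) ->
  concave_nonneg (Derive_n h 2) -> hedge h.
Proof.
  intros Heven [D1 [D2 _]] h0 h1 h2 Hinc Hconc.
  assert (d1 : forall x, is_derive h x (Derive h x)) by (intros; apply Derive_correct, D1).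
  assert (d2 : forall x, is_derive (Derive h) x (Derive_n h 2 x))
    by (intros; apply Derive_correct, D2).
  set (h' := Derive h) in *. set (h'' := Derive_n h 2) in *.
  assert (s1 : forall t x, is_derive (fun x => h (t * x)) x (t * h' (t * x))).
  { intros t x. apply (is_derive_comp h (fun x => t * x) x _ t); [apply d1|].
    auto_derive; [trivial|ring]. }
  assert (s2 : forall t x, is_derive (fun x => h' (t * x)) x (t * h'' (t * x))).
  { intros t x. apply (is_derive_comp h' (fun x => t * x) x _ t); [apply d2|].
    auto_derive; [trivial|ring]. }
  assert (lin2 : forall (f g : R -> R) a b x f' g', is_derive f x f' -> is_derive g x g' ->
            is_derive (fun x => a * f x - b * g x) x (a * f' - b * g')).
  { intros f g a b x f' g' Hf Hg.
    apply (is_derive_minus (fun x => a * f x) (fun x => b * g x) x (a * f') (b * g'));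
    apply is_derive_scal; assumption. }
  split.
  - exact Heven.
  - exact h0.
  - apply (pos_of_derive_pos h h' d1 h0). apply (pos_of_derive_pos h' h'' d2 h1).
    intros x Hx. rewrite <- h2. apply Hinc; lra.
  - intros t x Ht Hx.
    enough (0 <= 1 * h (t * x) - t ^ 3 * h x) by lra. revert x Hx.
    apply (nonneg_of_derive_nonneg _ (fun x => t * h' (t * x) - t ^ 3 * h' x)).
    + intro x. replace (t * h' (t * x)) with (1 * (t * h' (t * x))) by ring. now apply lin2.
    + rewrite Rmult_0_r, h0. ring.
    + apply (nonneg_of_derive_nonneg _ (fun x => t * (t * h'' (t * x)) - t ^ 3 * h'' x)).
      * intro x. now apply lin2.
      * rewrite Rmult_0_r, h1. ring.
      * intros x Hx. pose proof (Hconc x 0 t Hx (Rle_refl 0) Ht) as C.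
        fold h'' in C. rewrite Rmult_0_r, Rplus_0_r in C. rewrite h2 in C. nra.
  - intros t x Ht Hx.
    enough (0 <= t ^ 2 * h x - 1 * h (t * x)) by lra. revert x Hx.
    apply (nonneg_of_derive_nonneg _ (fun x => t ^ 2 * h' x - t * h' (t * x))).
    + intro x. replace (t * h' (t * x)) with (1 * (t * h' (t * x))) by ring. now apply lin2.
    + rewrite Rmult_0_r, h0. ring.
    + apply (nonneg_of_derive_nonneg _ (fun x => t ^ 2 * h'' x - t * (t * h'' (t * x)))).
      * intro x. now apply lin2.
      * rewrite Rmult_0_r, h1. ring.
      * intros x Hx.
        assert (h'' (t * x) <= h'' x).
        { destruct (Req_dec (t * x) x) as [E|N]; [rewrite E; lra|].
          apply Rlt_le, Hinc; nra. }
        nra.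
Qed.

Section HedgeFacts.
Context (h : R -> R) (Hh : hedge h).

Lemma hedge_abs x : h (Rabs x) = h x.
Proof.
  unfold Rabs. destruct (Rcase_abs x); [apply (hedge_even h Hh)|reflexivity].
Qed.

Lemma hedge_nonneg x : 0 <= h x.
Proof.
  rewrite <- hedge_abs. destruct (Rabs_pos x) as [H|H].
  - apply Rlt_le, (hedge_pos h Hh), H.
  - rewrite <- H, (hedge_zero h Hh). lra.
Qed.

Lemma hedge_ratio_cubic x b : 0 < b -> Rabs x <= b -> (Rabs x / b) ^ 3 <= h x / h b.
Proof.
  intros Hb Hx. assert (P := hedge_pos h Hh b Hb).
  assert (0 <= Rabs x / b) by (apply Rdiv_le_0_compat; [apply Rabs_pos|lra]).
  assert (Rabs x / b <= 1) by (apply div_le; lra).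
  assert (C := hedge_cubic h Hh (Rabs x / b) b (conj H H0) (Rlt_le _ _ Hb)).
  replace (Rabs x / b * b) with (Rabs x) in C by (field; lra).
  rewrite hedge_abs in C. apply (le_div _ _ _ P). exact C.
Qed.

Lemma hedge_ratio_quadratic x b : 0 < b -> b <= Rabs x -> (Rabs x / b) ^ 2 <= h x / h b.
Proof.
  intros Hb Hx. assert (P := hedge_pos h Hh b Hb).
  assert (0 <= b / Rabs x) by (apply Rdiv_le_0_compat; lra).
  assert (b / Rabs x <= 1) by (apply div_le; lra).
  assert (C := hedge_quadratic h Hh (b / Rabs x) (Rabs x) (conj H H0) (Rabs_pos x)).
  replace (b / Rabs x * Rabs x) with b in C by (field; lra).
  rewrite hedge_abs in C. apply (le_div _ _ _ P).
  apply Rmult_le_compat_l with (r := (Rabs x / b) ^ 2) in C; [|apply pow2_ge_0].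
  replace ((Rabs x / b) ^ 2 * ((b / Rabs x) ^ 2 * h x)) with (h x) in C by (field; lra).
  exact C.
Qed.

Lemma hedge_unbounded B : exists b0, 0 < b0 /\ forall b, b0 <= b -> B <= h b.
Proof.
  assert (P := hedge_pos h Hh 1 Rlt_0_1).
  exists (1 + Rabs B / h 1).
  assert (0 <= Rabs B / h 1) by (apply Rdiv_le_0_compat; [apply Rabs_pos|lra]).
  split; [lra|]. intros b Hb.
  assert (C := hedge_ratio_quadratic b 1 Rlt_0_1).
  rewrite Rabs_pos_eq in C by lra. specialize (C ltac:(lra)).
  rewrite Rdiv_1_r in C. apply (mult_le_of_le_div _ _ _ P) in C.
  assert (Rabs B / h 1 <= b ^ 2) by nra.
  apply (le_mult_of_div_le _ _ _ P) in H0. assert (X := Rle_abs B). lra.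
Qed.

(** Coherence is tested on one long h-ticket financed by selling c = h(s)/s^2 units of
    y^2, where s = sqrt v / 2. Since h(y) >= c y^2 for |y| >= s, the loss on the
    outcome is at most h(s), against a price difference of 4 h(s) - w. *)
Lemma coherent_hedge_bound f : legal f -> coherent h f -> h (sqrt (fc_v f)) <= 4 * fc_w f.
Proof.
  intros [Hv _] Hc. set (v := fc_v f) in *.
  destruct Hv as [Hv|Hv].
  2:{ rewrite <- Hv, sqrt_0, (hedge_zero h Hh).
      destruct (Hc (Bet 0 0 1)) as [x Hx]. unfold gain in Hx; cbn [bet_M bet_V bet_W] in Hx.
      pose proof (hedge_nonneg (x - fc_m f)). lra. }
  set (s := sqrt v / 2). assert (Hs0 := sqrt_lt_R0 v Hv).
  assert (Hs : 0 < s) by (unfold s; lra).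
  assert (Es : s ^ 2 = v / 4).
  { unfold s. replace ((sqrt v / 2) ^ 2) with (sqrt v ^ 2 / 4) by field.
    rewrite pow2_sqrt by lra. reflexivity. }
  destruct (Hc (Bet 0 (- (h s / s ^ 2)) 1)) as [x Hx].
  unfold gain in Hx; cbn [bet_M bet_V bet_W] in Hx.
  fold v in Hx. set (y := x - fc_m f) in *.
  set (c := h s / s ^ 2) in *.
  assert (Ps := hedge_pos h Hh s Hs).
  assert (Ec : c * v = 4 * h s).
  { unfold c. rewrite Es. field. lra. }
  assert (Hlow : c * y ^ 2 - h s <= h y).
  { destruct (Rle_lt_dec s (Rabs y)) as [L|L].
    - pose proof (hedge_ratio_quadratic y s Hs L) as Q.
      apply (mult_le_of_le_div _ _ _ Ps) in Q.
      replace ((Rabs y / s) ^ 2 * h s) with (c * y ^ 2) in Q; [lra|].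
      unfold c. rewrite <- (pow2_abs y). field. lra.
    - pose proof (hedge_nonneg y).
      assert (y ^ 2 <= s ^ 2).
      { rewrite <- (pow2_abs y). apply pow_incr. split; [apply Rabs_pos|lra]. }
      assert (c * s ^ 2 = h s) by (unfold c; field; lra).
      assert (0 < c) by (unfold c; apply Rdiv_lt_0_compat; [lra|apply pow_lt; lra]).
      nra. }
  assert (W : 3 * h s <= fc_w f).
  { replace (- c * (y ^ 2 - v)) with (c * v - c * y ^ 2) in Hx by ring. lra. }
  assert (C := hedge_cubic h Hh (1/2) (sqrt v) ltac:(lra) (sqrt_pos v)).
  replace (1 / 2 * sqrt v) with s in C by (unfold s; field). lra.
Qed.

End HedgeFacts.

(** * Exponential and iterated logarithm *)

Lemma exp_ge_quadratic u : 0 <= u -> 1 + u + u ^ 2 / 2 <= exp u.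
Proof.
  intros Hu. enough (0 <= exp u - (1 + u + u ^ 2 / 2)) by lra. revert u Hu.
  apply (nonneg_of_derive_nonneg _ (fun u => exp u - (1 + u))).
  - intro x. auto_derive; [trivial|field].
  - rewrite exp_0. field.
  - intros x Hx. pose proof (exp_ineq1_le x). lra.
Qed.

Lemma exp_neg_le_quadratic t : 0 <= t -> exp (- t) <= 1 - t + t ^ 2 / 2.
Proof.
  intros Ht. enough (0 <= 1 - t + t ^ 2 / 2 - exp (- t)) by lra. revert t Ht.
  apply (nonneg_of_derive_nonneg _ (fun t => - 1 + t + exp (- t))).
  - intro x. auto_derive; [trivial|field].
  - rewrite Ropp_0, exp_0. field.
  - intros x Hx. pose proof (exp_ineq1_le (- x)). lra.
Qed.

Lemma exp_neg_ge_cubic t : 0 <= t -> 1 - t + t ^ 2 / 2 - t ^ 3 / 6 <= exp (- t).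
Proof.
  intros Ht. enough (0 <= exp (- t) - (1 - t + t ^ 2 / 2 - t ^ 3 / 6)) by lra. revert t Ht.
  apply (nonneg_of_derive_nonneg _ (fun t => 1 - t + t ^ 2 / 2 - exp (- t))).
  - intro x. auto_derive; [trivial|field].
  - rewrite Ropp_0, exp_0. field.
  - intros x Hx. pose proof (exp_neg_le_quadratic x Hx). lra.
Qed.

Lemma exp_lower u : 1 + u + u ^ 2 / 2 - Rabs u ^ 3 / 6 <= exp u.
Proof.
  destruct (Rle_lt_dec 0 u) as [H|H].
  - rewrite Rabs_pos_eq by lra. pose proof (exp_ge_quadratic u H).
    pose proof (pow_le u 3 H). lra.
  - rewrite Rabs_left by lra. pose proof (exp_neg_ge_cubic (- u) ltac:(lra)) as E.
    rewrite Ropp_involutive in E. nra.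
Qed.

(** For u >= 0 the claim follows from the cubic minorant of exp (-u): its product
    with the right-hand side is at least 1. *)
Lemma exp_upper u : Rabs u <= 1 / 2 -> exp u <= 1 + u + u ^ 2 / 2 + Rabs u ^ 3.
Proof.
  intros Hu. destruct (Rle_lt_dec 0 u) as [H|H].
  - rewrite Rabs_pos_eq in * by lra. pose proof (exp_neg_ge_cubic u H) as E.
    assert (P := exp_pos u). assert (Q : exp u * exp (- u) = 1)
      by (rewrite <- exp_plus, Rplus_opp_r; apply exp_0).
    assert (K : 1 <= (1 + u + u ^ 2 / 2 + u ^ 3) * (1 - u + u ^ 2 / 2 - u ^ 3 / 6)).
    { enough (0 <= u ^ 3 * (5 / 6 - 11 / 12 * u + 5 / 12 * u ^ 2 - u ^ 3 / 6)) by lra.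
      apply Rmult_le_pos; [apply pow_le; lra|]. nra. }
    assert (0 <= 1 + u + u ^ 2 / 2 + u ^ 3) by nra.
    assert (K2 : 1 <= (1 + u + u ^ 2 / 2 + u ^ 3) * exp (- u)) by nra.
    apply Rmult_le_compat_l with (r := exp u) in K2; [|lra].
    replace (exp u * ((1 + u + u ^ 2 / 2 + u ^ 3) * exp (- u))) with
     ((1 + u + u ^ 2 / 2 + u ^ 3) * (exp u * exp (- u))) in K2 by ring.
    rewrite Q in K2. lra.
  - rewrite Rabs_left in * by lra. pose proof (exp_neg_le_quadratic (- u) ltac:(lra)) as E.
    rewrite Ropp_involutive in E. pose proof (pow_le (- u) 3 ltac:(lra)). nra.
Qed.

Lemma exp_le_one_minus x : 0 <= x <= 1 / 2 -> exp (- (x + x ^ 2)) <= 1 - x.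
Proof.
  intros [H0 H1].
  pose proof (exp_ge_quadratic (x + x ^ 2) ltac:(nra)) as E.
  assert (P := exp_pos (- (x + x ^ 2))).
  assert (Q : exp (x + x ^ 2) * exp (- (x + x ^ 2)) = 1)
    by (rewrite <- exp_plus, Rplus_opp_r; apply exp_0).
  assert (K : 1 <= (1 - x) * (1 + (x + x ^ 2) + (x + x ^ 2) ^ 2 / 2)).
  { enough (0 <= x ^ 2 * ((1 - x) * (1 + x) ^ 2 / 2 - x)) by lra.
    apply Rmult_le_pos; [apply pow2_ge_0|]. nra. }
  assert (K2 : 1 <= (1 - x) * exp (x + x ^ 2)) by nra.
  apply Rmult_le_compat_r with (r := exp (- (x + x ^ 2))) in K2; [|lra].
  rewrite Rmult_assoc, Q in K2. lra.
Qed.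

Lemma exp_le_one_minus_double x : 0 <= x <= 1 / 2 -> exp (- (2 * x)) <= 1 - x.
Proof.
  intros H. apply Rle_trans with (2 := exp_le_one_minus x H).
  destruct (Req_dec (- (2 * x)) (- (x + x ^ 2))) as [E|E]; [rewrite E; lra|].
  left. apply exp_increasing. nra.
Qed.

Lemma exp_mono x y : x <= y -> exp x <= exp y.
Proof.
  intros [H|H]; [left; now apply exp_increasing|right; now rewrite H].
Qed.

(** Relative capital after the polynomial bet that imitates an exponential
    martingale: u = lambda y and r^2 = lambda^2 v. *)
Definition factor (u r : R) : R := 1 + u + (u ^ 2 - r ^ 2) / 2.

(** Absorbs the mixed terms u r^2, so that the errors below contain pure cubes only:
    those are what the hedge controls. *)
Lemma cube_young a b : 0 <= a -> 0 <= b -> a * b ^ 2 <= a ^ 3 + b ^ 3.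
Proof.
  intros Ha Hb. destruct (Rle_lt_dec a b) as [L|L].
  - pose proof (pow_le a 3 Ha).
    assert (0 <= (b - a) * b ^ 2) by (apply Rmult_le_pos; [lra|apply pow2_ge_0]). nra.
  - pose proof (pow_le b 3 Hb).
    assert (0 <= a * (a ^ 2 - b ^ 2)) by (apply Rmult_le_pos; nra). nra.
Qed.

Lemma factor_upper u r : Rabs u <= 1 -> 0 <= r ->
  factor u r <= exp (u - r ^ 2 / 2 + (2 * Rabs u ^ 3 + r ^ 3)).
Proof.
  intros Hu Hr. set (a := Rabs u) in *.
  assert (Ha : 0 <= a) by apply Rabs_pos.
  assert (Hua : - a <= u <= a).
  { unfold a; split; [|apply Rle_abs]. pose proof (Rle_abs (- u)). rewrite Rabs_Ropp in *. lra. }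
  pose proof (exp_lower u) as L. fold a in L.
  assert (P := exp_pos u).
  assert (I3 : exp (- u) <= 3).
  { apply Rle_trans with (exp 1); [apply exp_mono; lra|apply exp_le_3]. }
  assert (I1 : 1 - a <= exp (- u)).
  { pose proof (exp_ineq1_le (- u)). lra. }
  assert (Q : exp u * exp (- u) = 1)
    by (rewrite <- exp_plus, Rplus_opp_r; apply exp_0).
  assert (P' := exp_pos (- u)).
  replace (u - r ^ 2 / 2 + (2 * a ^ 3 + r ^ 3)) with (u + (- (r ^ 2 / 2) + (2 * a ^ 3 + r ^ 3))) by ring.
  rewrite exp_plus.
  apply Rle_trans with (exp u * (1 + exp (- u) * (a ^ 3 / 6 - r ^ 2 / 2))).
  - replace (exp u * (1 + exp (- u) * (a ^ 3 / 6 - r ^ 2 / 2))) with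
      (exp u + (exp u * exp (- u)) * (a ^ 3 / 6 - r ^ 2 / 2)) by ring.
    rewrite Q. unfold factor. lra.
  - apply Rmult_le_compat_l; [lra|].
    apply Rle_trans with (2 := exp_ineq1_le _).
    pose proof (pow_le a 3 Ha). pose proof (pow2_ge_0 r). pose proof (cube_young a r Ha Hr).
    pose proof (pow_le r 3 Hr).
    assert (exp (- u) * (a ^ 3 / 6) <= 3 * (a ^ 3 / 6)) by (apply Rmult_le_compat_r; lra).
    assert ((1 - a) * (r ^ 2 / 2) <= exp (- u) * (r ^ 2 / 2)) by (apply Rmult_le_compat_r; lra).
    lra.
Qed.

Lemma factor_lower u r : Rabs u <= 1 / 2 -> 0 <= r <= 1 / 2 ->
  exp (u - r ^ 2 / 2 - (5 * Rabs u ^ 3 + 2 * r ^ 3)) <= factor u r.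
Proof.
  intros Hu [Hr Hr2]. set (a := Rabs u) in *.
  assert (Ha : 0 <= a) by apply Rabs_pos.
  assert (Hua : - a <= u <= a).
  { unfold a; split; [|apply Rle_abs]. pose proof (Rle_abs (- u)). rewrite Rabs_Ropp in *. lra. }
  pose proof (exp_upper u Hu) as L. fold a in L.
  assert (P := exp_pos u).
  assert (P' := exp_pos (- u)).
  assert (I1 : exp (- u) <= 1 + 2 * a).
  { pose proof (exp_upper (- u)) as X. rewrite Rabs_Ropp in X. fold a in X. specialize (X Hu).
    assert (a ^ 3 <= a / 4) by nra. replace ((- u) ^ 2) with (a ^ 2) in X.
    - assert (a ^ 2 <= a / 2) by nra. lra.
    - unfold a. rewrite pow2_abs. ring. }
  assert (Q : exp u * exp (- u) = 1)
    by (rewrite <- exp_plus, Rplus_opp_r; apply exp_0).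
  pose proof (pow_le a 3 Ha). pose proof (pow2_ge_0 r). pose proof (cube_young a r Ha Hr).
  pose proof (pow_le r 3 Hr).
  set (q := a ^ 3 + r ^ 2 / 2). set (x := exp (- u) * q).
  assert (Hq : 0 <= q <= 1 / 4).
  { unfold q. split; [lra|]. assert (a ^ 3 <= (1/2) ^ 3) by (apply pow_incr; lra).
    assert (r ^ 2 <= (1/2) ^ 2) by (apply pow_incr; lra). lra. }
  assert (Hx : 0 <= x <= 2 * q) by (unfold x; split; nra).
  assert (X1 : x <= r ^ 2 / 2 + 3 * a ^ 3 + r ^ 3).
  { apply Rle_trans with ((1 + 2 * a) * q); [apply Rmult_le_compat_r; lra|].
    unfold q. assert (a * a ^ 3 <= a ^ 3 / 2) by nra. nra. }
  assert (X2 : x ^ 2 <= 2 * a ^ 3 + r ^ 3).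
  { apply Rle_trans with ((2 * q) ^ 2); [apply pow_incr; lra|]. unfold q.
    replace ((2 * (a ^ 3 + r ^ 2 / 2)) ^ 2) with
      (4 * (a ^ 3) * a ^ 3 + 4 * a ^ 3 * r ^ 2 + r * r ^ 3) by field.
    assert (a ^ 3 <= (1/2) ^ 3) by (apply pow_incr; lra).
    assert (r ^ 2 <= (1/2) ^ 2) by (apply pow_incr; lra).
    assert (a ^ 3 * r ^ 2 <= a ^ 3 * (1/2) ^ 2) by (apply Rmult_le_compat_l; lra).
    assert (a ^ 3 * a ^ 3 <= a ^ 3 * (1/2) ^ 3) by (apply Rmult_le_compat_l; lra).
    assert (r * r ^ 3 <= 1 / 2 * r ^ 3) by (apply Rmult_le_compat_r; lra).
    lra. }
  apply Rle_trans with (exp u * (1 - x)).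
  - apply Rle_trans with (exp u * exp (- (x + x ^ 2))).
    + rewrite <- exp_plus. apply exp_mono. lra.
    + apply Rmult_le_compat_l; [lra|]. apply exp_le_one_minus. lra.
  - unfold x. replace (exp u * (1 - exp (- u) * q)) with (exp u - (exp u * exp (- u)) * q) by ring.
    rewrite Q. unfold factor, q. lra.
Qed.

Lemma exp1_gt_2 : 2 < exp 1.
Proof. pose proof (exp_ineq1 1). lra. Qed.

Lemma ln_mono x y : 0 < x -> x <= y -> ln x <= ln y.
Proof. intros Hx [H|H]; [left; now apply ln_increasing|right; now rewrite H]. Qed.

Lemma ln_le_pred x : 0 < x -> ln x <= x - 1.
Proof.
  intros Hx. pose proof (exp_ineq1_le (ln x)) as E. rewrite exp_ln in E by lra. lra.
Qed.

Lemma ln_ge_exp1 A : exp (exp 1) <= A -> exp 1 <= ln A.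
Proof.
  intros H. rewrite <- (ln_exp (exp 1)). apply ln_mono; [apply exp_pos|exact H].
Qed.

Lemma lnln_ge_1 A : exp (exp 1) <= A -> 1 <= ln (ln A).
Proof.
  intros H. rewrite <- (ln_exp 1). apply ln_mono; [apply exp_pos|now apply ln_ge_exp1].
Qed.

Lemma lnln_mono A B : exp (exp 1) <= A -> A <= B -> ln (ln A) <= ln (ln B).
Proof.
  intros H L. pose proof exp1_gt_2. pose proof (ln_ge_exp1 A H). pose proof (exp_pos (exp 1)).
  apply ln_mono; [lra|]. apply ln_mono; lra.
Qed.

(** Two uses of ln t <= t - 1: lnln B - lnln A <= ln B / ln A - 1 <= ln B - ln A
    <= B / A - 1. *)
Lemma lnln_div_antitone A B : exp (exp 1) <= A -> A <= B ->
  ln (ln B) / B <= ln (ln A) / A.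
Proof.
  intros H L. pose proof exp1_gt_2. pose proof (ln_ge_exp1 A H). pose proof (exp_pos (exp 1)).
  pose proof (lnln_ge_1 A H).
  assert (lAB : ln A <= ln B) by (apply ln_mono; lra).
  apply div_le; [lra|]. replace (ln (ln A) / A * B) with (ln (ln A) * (B / A)) by (field; lra).
  assert (E1 : ln (ln B) - ln (ln A) <= ln B / ln A - 1).
  { rewrite <- ln_div by lra. apply ln_le_pred. apply Rdiv_lt_0_compat; lra. }
  assert (E2 : ln B - ln A <= B / A - 1).
  { rewrite <- ln_div by lra. apply ln_le_pred. apply Rdiv_lt_0_compat; lra. }
  assert (E3 : ln B / ln A - 1 <= ln B - ln A).
  { replace (ln B / ln A - 1) with ((ln B - ln A) / ln A) by (field; lra).
    apply div_le; [lra|]. nra. }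
  nra.
Qed.

(** A crude bound that makes b_n tend to infinity with A_n. *)
Lemma sqrt_half_le A : exp (exp 1) <= A -> sqrt A / 2 <= A / ln (ln A).
Proof.
  intros H. pose proof exp1_gt_2. pose proof (ln_ge_exp1 A H). pose proof (exp_pos (exp 1)).
  pose proof (lnln_ge_1 A H).
  assert (S := sqrt_lt_R0 A ltac:(lra)).
  assert (E1 : ln (ln A) <= ln A) by (pose proof (ln_le_pred (ln A)); lra).
  assert (E2 : ln A <= 2 * sqrt A).
  { replace (ln A) with (ln (sqrt A * sqrt A)) by (now rewrite sqrt_sqrt by lra).
    rewrite ln_mult by lra. pose proof (ln_le_pred (sqrt A) S). lra. }
  apply le_div; [lra|].
  apply Rle_trans with (sqrt A / 2 * (2 * sqrt A)).
  - apply Rmult_le_compat_l; lra.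
  - replace (sqrt A / 2 * (2 * sqrt A)) with (sqrt A * sqrt A) by field.
    rewrite sqrt_sqrt; lra.
Qed.

Definition block (rho A : R) : nat := Z.to_nat (Int_part (ln A / ln rho)).

Lemma block_spec rho A : 1 < rho -> 1 <= A ->
  rho ^ block rho A <= A < rho ^ S (block rho A).
Proof.
  intros Hr HA.
  assert (lr : 0 < ln rho) by (rewrite <- ln_1; apply ln_increasing; lra).
  assert (lA : 0 <= ln A) by (rewrite <- ln_1; apply ln_mono; lra).
  set (t := ln A / ln rho).
  assert (Ht : 0 <= t) by (apply Rdiv_le_0_compat; lra).
  destruct (base_Int_part t) as [B1 B2].
  assert (Hz : (0 <= Int_part t)%Z).
  { apply Z.lt_succ_r, lt_IZR. rewrite succ_IZR. lra. }
  assert (EA : A = exp (t * ln rho)).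
  { unfold t. replace (ln A / ln rho * ln rho) with (ln A) by (field; lra).
    symmetry; apply exp_ln; lra. }
  assert (EI : INR (block rho A) = IZR (Int_part t)).
  { unfold block. rewrite INR_IZR_INZ, Z2Nat.id; [reflexivity|exact Hz]. }
  rewrite <- !Rpower_pow by lra. unfold Rpower. rewrite S_INR, EI.
  split.
  - rewrite EA. apply exp_mono. apply Rmult_le_compat_r; lra.
  - rewrite EA. apply exp_increasing. apply Rmult_lt_compat_r; lra.
Qed.

Lemma pow_lt_inv rho j k : 1 < rho -> rho ^ j < rho ^ k -> (j < k)%nat.
Proof.
  intros Hr H. destruct (Nat.lt_ge_cases j k) as [L|L]; [exact L|].
  exfalso. assert (rho ^ k <= rho ^ j) by (apply Rle_pow; [lra|exact L]). lra.
Qed.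

Lemma ln_ln_pow rho k : 1 < rho -> (1 <= k)%nat ->
  ln (ln (rho ^ k)) = ln (INR k) + ln (ln rho).
Proof.
  intros Hr Hk. assert (lr : 0 < ln rho) by (rewrite <- ln_1; apply ln_increasing; lra).
  rewrite <- Rpower_pow by lra. unfold Rpower. rewrite ln_exp.
  apply ln_mult; [|lra]. apply lt_0_INR. lia.
Qed.

(** * Mixtures of betting processes, and savings *)

(** Histories list the latest round first. A process is a function of the history
    alone, so it cannot anticipate, and its recursion is the capital update of
    the game. Stakes bounded by the capital keep countable mixtures convergent
    against arbitrary moves. *)
Record martingale (h : R -> R) := Martingale {
  val : list (forecast * R) -> R;
  stake : list (forecast * R) -> forecast -> bet;
  val_nil : val nil = 1;
  val_cons : forall l f x, val ((f, x) :: l) = val l + gain h f (stake l f) x;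
  val_pos : forall l, 0 < val l;
  stake_bound : forall l f, Rabs (bet_M (stake l f)) <= val l /\
    Rabs (bet_V (stake l f)) <= val l /\ Rabs (bet_W (stake l f)) <= val l }.

Arguments val {h}.
Arguments stake {h}.
Arguments val_nil {h}.
Arguments val_cons {h}.
Arguments val_pos {h}.
Arguments stake_bound {h}.

Fixpoint past (f : nat -> forecast) (x : nat -> R) (n : nat) : list (forecast * R) :=
  match n with O => nil | S k => (f k, x k) :: past f x k end.

Lemma ex_series_bounded p a D : (forall i, 0 <= p i) -> is_series p 1 ->
  (forall i, Rabs (a i) <= D) -> ex_series (fun i => p i * a i).
Proof.
  intros Hp Hs Ha. apply (@ex_series_le R_AbsRing R_CompleteNormedModule _ (fun i => p i * D)).
  - intro i. change (Rabs (p i * a i) <= p i * D). rewrite Rabs_mult, (Rabs_pos_eq (p i)) by apply Hp.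
    apply Rmult_le_compat_l; auto.
  - exists (1 * D). now apply (is_series_scal_r D p 1).
Qed.

Lemma term_le_Series a k : (forall i, 0 <= a i) -> ex_series a -> a k <= Series a.
Proof.
  intros Ha He. apply Rle_trans with (sum_n a k).
  - destruct k as [|k]; [rewrite sum_O; lra|]. rewrite sum_Sn.
    change (a (S k) <= sum_n a k + a (S k)).
    enough (0 <= sum_n a k) by lra. rewrite sum_n_Reals. now apply cond_pos_sum.
  - apply (is_lim_seq_incr_compare (sum_n a)).
    + exact (Series_correct a He).
    + intro n. rewrite sum_Sn. change (sum_n a n <= sum_n a n + a (S n)). specialize (Ha (S n)). lra.
Qed.

Section Mixture.
Context {h : R -> R} (p : nat -> R) (p_pos : forall i, 0 < p i) (p_sum : is_series p 1)
  (F : nat -> martingale h).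

(** Common to all processes, whence the convergence of the series of stakes. *)
Fixpoint growth_bound (l : list (forecast * R)) : R :=
  match l with
  | nil => 1
  | (f, x) :: l' => growth_bound l' * (1 + Rabs (x - fc_m f) + Rabs ((x - fc_m f) ^ 2 - fc_v f)
                              + Rabs (h (x - fc_m f) - fc_w f))
  end.

Lemma val_le_growth_bound (m : martingale h) l : val m l <= growth_bound l.
Proof.
  induction l as [|[f x] l IH].
  - rewrite val_nil. simpl. lra.
  - rewrite val_cons. cbn [growth_bound]. destruct (stake_bound m l f) as [B1 [B2 B3]].
    unfold gain.
    assert (T : forall c y, Rabs c <= val m l -> c * y <= val m l * Rabs y).
    { intros c y Hc. apply Rle_trans with (1 := Rle_abs _). rewrite Rabs_mult.
      apply Rmult_le_compat_r; [apply Rabs_pos|exact Hc]. }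
    pose proof (T _ (x - fc_m f) B1). pose proof (T _ ((x - fc_m f) ^ 2 - fc_v f) B2).
    pose proof (T _ (h (x - fc_m f) - fc_w f) B3).
    pose proof (Rabs_pos (x - fc_m f)). pose proof (Rabs_pos ((x - fc_m f) ^ 2 - fc_v f)).
    pose proof (Rabs_pos (h (x - fc_m f) - fc_w f)).
    apply Rle_trans with (val m l * (1 + Rabs (x - fc_m f) + Rabs ((x - fc_m f) ^ 2 - fc_v f)
                              + Rabs (h (x - fc_m f) - fc_w f))); [lra|].
    apply Rmult_le_compat_r; lra.
Qed.

Let p_nonneg i : 0 <= p i := Rlt_le _ _ (p_pos i).

Lemma ex_series_weighted (a : nat -> R) l : (forall i, Rabs (a i) <= val (F i) l) ->
  ex_series (fun i => p i * a i).
Proof.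
  intros Ha. apply (ex_series_bounded p a (growth_bound l) p_nonneg p_sum).
  intro i. eapply Rle_trans; [apply Ha|apply val_le_growth_bound].
Qed.

Lemma ex_series_val l : ex_series (fun i => p i * val (F i) l).
Proof.
  apply ex_series_weighted with (l := l). intro i.
  rewrite Rabs_pos_eq; [lra|]. apply Rlt_le, val_pos.
Qed.

Lemma ex_series_stake l f :
  ex_series (fun i => p i * bet_M (stake (F i) l f)) /\
  ex_series (fun i => p i * bet_V (stake (F i) l f)) /\
  ex_series (fun i => p i * bet_W (stake (F i) l f)).
Proof.
  repeat split; apply ex_series_weighted with (l := l); intro i; apply stake_bound.
Qed.

Lemma Series_weighted_bound (a : nat -> R) l : (forall i, Rabs (a i) <= val (F i) l) ->
  Rabs (Series (fun i => p i * a i)) <= Series (fun i => p i * val (F i) l).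
Proof.
  intros Ha.
  assert (Hle : forall i, Rabs (p i * a i) <= p i * val (F i) l).
  { intro i. rewrite Rabs_mult, Rabs_pos_eq by apply p_nonneg.
    apply Rmult_le_compat_l; [apply p_nonneg|apply Ha]. }
  eapply Rle_trans; [apply Series_Rabs|].
  - apply (@ex_series_le R_AbsRing R_CompleteNormedModule _ (fun i => p i * val (F i) l));
      [|apply ex_series_val].
    intro i. change (Rabs (Rabs (p i * a i)) <= p i * val (F i) l). rewrite Rabs_Rabsolu. apply Hle.
  - apply Series_le; [|apply ex_series_val]. intro i. split; [apply Rabs_pos|apply Hle].
Qed.

Program Definition mixture : martingale h := {|
  val l := Series (fun i => p i * val (F i) l);
  stake l f := Bet (Series (fun i => p i * bet_M (stake (F i) l f)))
                   (Series (fun i => p i * bet_V (stake (F i) l f)))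
                   (Series (fun i => p i * bet_W (stake (F i) l f))) |}.
Next Obligation.
  rewrite (Series_ext _ p).
  - apply is_series_unique, p_sum.
  - intro i. rewrite val_nil. ring.
Qed.
Next Obligation.
  destruct (ex_series_stake l f) as [E1 [E2 E3]]. assert (E0 := ex_series_val l).
  apply Series_correct in E0, E1, E2, E3. unfold gain. cbn [bet_M bet_V bet_W].
  apply is_series_unique.
  eapply (is_series_ext (fun i => p i * val (F i) l
      + (p i * bet_M (stake (F i) l f) * (x - fc_m f)
         + p i * bet_V (stake (F i) l f) * ((x - fc_m f) ^ 2 - fc_v f)
         + p i * bet_W (stake (F i) l f) * (h (x - fc_m f) - fc_w f)))).
  { intro i. rewrite val_cons. unfold gain.
    match goal with |- ?a = ?b => change (@eq R a b) end. ring. }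
  apply (is_series_plus (fun i => p i * val (F i) l) _ _ _ E0).
  apply (is_series_plus (fun i => p i * bet_M (stake (F i) l f) * (x - fc_m f)
         + p i * bet_V (stake (F i) l f) * ((x - fc_m f) ^ 2 - fc_v f))).
  - apply (is_series_plus (fun i => p i * bet_M (stake (F i) l f) * (x - fc_m f)));
      now apply is_series_scal_r.
  - now apply is_series_scal_r.
Qed.
Next Obligation.
  apply Rlt_le_trans with (p 0%nat * val (F 0%nat) l).
  - apply Rmult_lt_0_compat; [apply p_pos|apply val_pos].
  - apply (term_le_Series (fun i => p i * val (F i) l) 0).
    + intro i. apply Rmult_le_pos; [apply p_nonneg|apply Rlt_le, val_pos].
    + apply ex_series_val.
Qed.
Next Obligation.
  repeat split; apply Series_weighted_bound; intro i; apply stake_bound.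
Qed.

(** The purpose of mixing: on a path where the mixture is bounded, so is each
    component. *)
Lemma component_le_mixture i l : val (F i) l <= val mixture l / p i.
Proof.
  apply le_div; [apply p_pos|]. rewrite Rmult_comm.
  apply (term_le_Series (fun i => p i * val (F i) l) i).
  - intro j. apply Rmult_le_pos; [apply p_nonneg|apply Rlt_le, val_pos].
  - apply ex_series_val.
Qed.

End Mixture.

Section Savings.
Context {h : R -> R} (m : martingale h).

(** (saved, active): the active part follows m, and one unit is put aside whenever it
    reaches 2. It then stays at least 1, so the copying never stops. *)
Fixpoint bank (l : list (forecast * R)) : R * R :=
  match l with
  | nil => (0, 1)
  | fx :: l' => let (s, a) := bank l' in
      let a' := a * (val m l / val m l') in
      if Rle_dec 2 a' then (s + 1, a' - 1) else (s, a')
  end.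

Definition scaled_bet (c : R) (b : bet) : bet := Bet (c * bet_M b) (c * bet_V b) (c * bet_W b).

Definition savings_strategy : strategy := fun hist f =>
  let l := rev (map (fun r => (rd_forecast r, rd_x r)) hist) in
  scaled_bet (snd (bank l) / val m l) (stake m l f).

Lemma active_pos l : 0 < snd (bank l).
Proof.
  induction l as [|fx l IH]; [simpl; lra|]. cbn [bank].
  destruct (bank l) as [s a]. simpl in IH.
  assert (0 < a * (val m (fx :: l) / val m l)).
  { apply Rmult_lt_0_compat; [exact IH|]. apply Rdiv_lt_0_compat; apply val_pos. }
  cbv zeta. destruct (Rle_dec 2 _); simpl; lra.
Qed.

Lemma saved_nonneg l : 0 <= fst (bank l).
Proof.
  induction l as [|fx l IH]; [simpl; lra|]. cbn [bank].
  destruct (bank l) as [s a]. simpl in IH.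
  cbv zeta. destruct (Rle_dec 2 _); simpl; lra.
Qed.

Lemma bank_gain f x l :
  fst (bank ((f, x) :: l)) + snd (bank ((f, x) :: l)) =
  fst (bank l) + snd (bank l) + gain h f (scaled_bet (snd (bank l) / val m l) (stake m l f)) x.
Proof.
  cbn [bank]. destruct (bank l) as [s a]. simpl fst; simpl snd.
  assert (E : a * (val m ((f, x) :: l) / val m l) =
    a + gain h f (scaled_bet (a / val m l) (stake m l f)) x).
  { rewrite val_cons. unfold gain, scaled_bet. cbn [bet_M bet_V bet_W].
    field. apply Rgt_not_eq, val_pos. }
  destruct (Rle_dec 2 _); simpl fst; simpl snd; lra.
Qed.

Lemma past_of_history (q : play) n :
  rev (map (fun r => (rd_forecast r, rd_x r)) (history q n)) = past (forecasts q) (outcomes q) n.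
Proof.
  induction n as [|n IH]; [reflexivity|].
  unfold history in *. rewrite seq_S, !map_app, rev_app_distr, IH. reflexivity.
Qed.

Lemma savings_capital q : follows savings_strategy q -> forall n,
  capital h q n = fst (bank (past (forecasts q) (outcomes q) n))
                + snd (bank (past (forecasts q) (outcomes q) n)).
Proof.
  intros Hf n. induction n as [|n IH]; [simpl; lra|].
  cbn [capital past]. rewrite bank_gain, <- IH, Hf.
  unfold savings_strategy. rewrite past_of_history. reflexivity.
Qed.

Lemma saved_increases f x n j : fst (bank (past f x n)) <= fst (bank (past f x (j + n))).
Proof.
  induction j as [|j IH]; [simpl; lra|]. apply Rle_trans with (1 := IH).
  cbn [Nat.add past bank]. destruct (bank (past f x (j + n))) as [s a].
  cbv zeta. destruct (Rle_dec 2 _); simpl; lra.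
Qed.

(** Otherwise the active part would be a fixed multiple of an unbounded process while
    staying below 2. *)
Lemma saved_grows f x : (forall C, exists n, C < val m (past f x n)) ->
  forall n, exists j, fst (bank (past f x n)) + 1 <= fst (bank (past f x (j + n))).
Proof.
  intros Hunb n. apply NNPP. intro Hno.
  set (V := fun i => val m (past f x i)). set (B := fun i => bank (past f x i)).
  assert (Hstep : forall j, snd (B (S j + n)%nat) = snd (B (j + n)%nat) * (V (S j + n)%nat / V (j + n)%nat)
      /\ snd (B (S j + n)%nat) < 2).
  { intro j. assert (N := fun H => Hno (ex_intro _ (S j) H)).
    pose proof (saved_increases f x n j) as I.
    unfold B, V. cbn [Nat.add past bank] in N |- *.
    destruct (bank (past f x (j + n))) as [s a]. simpl fst in I. simpl snd.
    cbv zeta in N |- *. destruct (Rle_dec 2 _); simpl in N |- *; [exfalso; apply N; lra|]. split; lra. }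
  assert (Hprop : forall j, snd (B (j + n)%nat) = snd (B n) * (V (j + n)%nat / V n)).
  { assert (P : forall i, V i <> 0) by (intro i; apply Rgt_not_eq, val_pos).
    induction j as [|j IH].
    - simpl. field. apply P.
    - rewrite (proj1 (Hstep j)), IH. field. split; apply P. }
  (* If nothing more is saved after round n, then the active part is a fixed multiple of
     val m, and it stays below 2. *)
  assert (Ppos : 0 < snd (B n)) by apply active_pos.
  assert (Vpos : 0 < V n) by apply val_pos.
  assert (Hbd : forall j, V (S j + n)%nat <= 2 * V n / snd (B n)).
  { intro j. apply le_div; [exact Ppos|]. pose proof (proj2 (Hstep j)) as L.
    rewrite Hprop in L.
    replace (snd (B n) * (V (S j + n)%nat / V n)) with (V (S j + n)%nat * snd (B n) / V n) in L
      by (field; lra).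
    left. apply (Rlt_div_l _ _ _ Vpos). exact L. }
  assert (Hmax : forall k, exists C, forall i, (i <= k)%nat -> V i <= C).
  { induction k as [|k [C HC]].
    - exists (V 0%nat). intros i Hi. replace i with 0%nat by lia. lra.
    - exists (Rmax C (V (S k))). intros i Hi.
      destruct (Nat.eq_dec i (S k)) as [->|Ne]; [apply Rmax_r|].
      apply Rle_trans with (2 := Rmax_l _ _). apply HC. lia. }
  destruct (Hmax n) as [C HC].
  destruct (Hunb (Rmax C (2 * V n / snd (B n)))) as [i Hi].
  assert (V i <= Rmax C (2 * V n / snd (B n))).
  { destruct (Nat.le_gt_cases i n) as [L|L].
    - apply Rle_trans with (2 := Rmax_l _ _). now apply HC.
    - apply Rle_trans with (2 := Rmax_r _ _).
      replace i with (S (i - n - 1) + n)%nat by lia. apply Hbd. }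
  exact (Rlt_not_le _ _ Hi H).
Qed.

Lemma saved_unbounded f x : (forall C, exists n, C < val m (past f x n)) ->
  forall k, exists n, INR k <= fst (bank (past f x n)).
Proof.
  intros Hunb k. induction k as [|k [n Hn]].
  - exists 0%nat. simpl. lra.
  - destruct (saved_grows f x Hunb n) as [j Hj]. exists (j + n)%nat. rewrite S_INR. lra.
Qed.

(** Reduces forcing an event to exhibiting one process that is unbounded on every
    path outside the event. *)
Lemma force_of_martingale (E : event) :
  (forall f x, (forall n, legal (f n)) -> (forall n, coherent h (f n)) ->
     (exists C, forall n, val m (past f x n) <= C) -> E f x) ->
  can_force h E.
Proof.
  intros HE. exists savings_strategy. intros q Hfol Hleg Hcoh. split.
  - intro n. rewrite savings_capital by exact Hfol.
    pose proof (saved_nonneg (past (forecasts q) (outcomes q) n)).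
    pose proof (active_pos (past (forecasts q) (outcomes q) n)). lra.
  - destruct (classic (exists C, forall n, val m (past (forecasts q) (outcomes q) n) <= C)) as [B|U].
    + left. now apply HE.
    + right. apply is_lim_seq_spec. intro M.
      assert (Hunb : forall C, exists n, C < val m (past (forecasts q) (outcomes q) n)).
      { intro C. apply NNPP. intro N. apply U. exists C. intro n.
        apply Rnot_lt_le. intro L. apply N. now exists n. }
      destruct (INR_unbounded M) as [k Hk].
      destruct (saved_unbounded _ _ Hunb k) as [n Hn]. exists n. intros i Hi.
      rewrite savings_capital by exact Hfol.
      pose proof (saved_increases (forecasts q) (outcomes q) n (i - n)) as I.
      replace (i - n + n)%nat with i in I by lia.
      pose proof (active_pos (past (forecasts q) (outcomes q) i)). lra.
Qed.

End Savings.

(** * Buying the hedge makes the deviations small *)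

Section Multiplicative.
Context {h : R -> R} (rb : list (forecast * R) -> forecast -> bet)
  (rb_bound : forall l f, Rabs (bet_M (rb l f)) <= 1 /\
     Rabs (bet_V (rb l f)) <= 1 /\ Rabs (bet_W (rb l f)) <= 1)
  (rb_pos : forall l f x, 0 < 1 + gain h f (rb l f) x).

Fixpoint product_val (l : list (forecast * R)) : R :=
  match l with
  | nil => 1
  | (f, x) :: l' => product_val l' * (1 + gain h f (rb l' f) x)
  end.

Lemma product_val_pos l : 0 < product_val l.
Proof.
  induction l as [|[f x] l IH]; [simpl; lra|].
  apply Rmult_lt_0_compat; [exact IH|apply rb_pos].
Qed.

Program Definition multiplicative : martingale h := {|
  val := product_val;
  stake l f := scaled_bet (product_val l) (rb l f) |}.
Next Obligation. unfold gain, scaled_bet; cbn [bet_M bet_V bet_W]. ring. Qed.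
Next Obligation. apply product_val_pos. Qed.
Next Obligation.
  assert (P := product_val_pos l).
  assert (T : forall c, Rabs c <= 1 -> Rabs (product_val l * c) <= product_val l).
  { intros c Hc. rewrite Rabs_mult, (Rabs_pos_eq (product_val l)) by lra. nra. }
  destruct (rb_bound l f) as [B1 [B2 B3]]. unfold scaled_bet; cbn [bet_M bet_V bet_W]. auto.
Qed.

End Multiplicative.

Fixpoint psum (a : nat -> R) (n : nat) : R :=
  match n with O => 0 | S k => psum a k + a k end.

Lemma psum_mono a : (forall i, 0 <= a i) -> forall n m, (n <= m)%nat -> psum a n <= psum a m.
Proof.
  intros Ha n m H. induction H as [|m H IH]; [lra|]. simpl. specialize (Ha m). lra.
Qed.

Lemma psum_plus a b n : psum (fun i => a i + b i) n = psum a n + psum b n.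
Proof. induction n as [|n IH]; simpl; lra. Qed.

Lemma sum_f_R0_psum a n : sum_f_R0 a n = psum a (S n).
Proof. induction n as [|n IH]; simpl in *; lra. Qed.

Lemma psum_tail a C : (forall i, 0 <= a i) -> (forall n, psum a n <= C) ->
  forall eta, 0 < eta -> exists N, forall n m, (N <= n)%nat -> (n <= m)%nat ->
    psum a m - psum a n <= eta.
Proof.
  intros Ha HC eta Heta.
  destruct (completeness (fun s => exists n, s = psum a n)) as [s [Hub Hlub]].
  - exists C. intros s [n ->]. apply HC.
  - exists 0, 0%nat. reflexivity.
  - destruct (classic (exists N, s - eta < psum a N)) as [[N HN]|No].
    + exists N. intros n m Hn Hm. assert (psum a m <= s) by (apply Hub; now exists m).
      pose proof (psum_mono a Ha N n Hn). lra.
    + exfalso. assert (s <= s - eta); [|lra]. apply Hlub. intros r [n ->].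
      apply Rnot_lt_le. intro L. apply No. now exists n.
Qed.

Definition variance (l : list (forecast * R)) : R :=
  fold_right (fun fx s => fc_v (fst fx) + s) 0 l.

Definition total_variance (l : list (forecast * R)) (f : forecast) : R := variance l + fc_v f.

Definition scale (A : R) : R := sqrt (A / ln (ln A)).

Definition var_sum (f : nat -> forecast) : nat -> R := psum (fun i => fc_v (f i)).

Definition dev (f : nat -> forecast) (x : nat -> R) (i : nat) : R := x i - fc_m (f i).

Definition dev_sum (f : nat -> forecast) (x : nat -> R) : nat -> R := psum (dev f x).

Lemma total_variance_past f x n : total_variance (past f x n) (f n) = var_sum f (S n).
Proof.
  assert (E : forall k, variance (past f x k) = var_sum f k).
  { induction k as [|k IH]; [reflexivity|].
    cbn [past variance fold_right fst]. unfold variance in IH. rewrite IH.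
    unfold var_sum; simpl. ring. }
  unfold total_variance. rewrite E. reflexivity.
Qed.

Lemma A_seq_var_sum f n : A_seq f n = var_sum f (S n).
Proof. apply sum_f_R0_psum. Qed.

Section SmallMoves.
Context (h : R -> R) (Hh : hedge h).

Lemma scale_pos A : exp 1 < A -> 0 < scale A.
Proof.
  intros H. pose proof exp1_gt_2. apply sqrt_lt_R0, Rdiv_lt_0_compat; [lra|].
  rewrite <- ln_1. apply ln_increasing; [lra|]. rewrite <- (ln_exp 1).
  apply ln_increasing; [apply exp_pos|exact H].
Qed.

(** The price condition keeps the capital positive, and 1 <= h(b) keeps the stake
    below the capital. *)
Definition hedge_condition (l : list (forecast * R)) (f : forecast) : Prop :=
  exp 1 < total_variance l f /\ 1 <= h (scale (total_variance l f)) /\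
  fc_w f / h (scale (total_variance l f)) <= 1 / 2.

Definition hedge_rule (l : list (forecast * R)) (f : forecast) : bet :=
  if excluded_middle_informative (hedge_condition l f)
  then Bet 0 0 (/ h (scale (total_variance l f))) else Bet 0 0 0.

Program Definition hedge_martingale : martingale h := multiplicative hedge_rule _ _.
Next Obligation.
  unfold hedge_rule. destruct excluded_middle_informative as [[_ [C _]]|_];
    cbn [bet_M bet_V bet_W]; rewrite ?Rabs_R0; repeat split; try lra.
  rewrite Rabs_pos_eq by (left; apply Rinv_0_lt_compat; lra).
  rewrite <- Rinv_1. apply Rinv_le_contravar; lra.
Qed.
Next Obligation.
  unfold hedge_rule. destruct excluded_middle_informative as [[_ [C1 C2]]|_];
    unfold gain; cbn [bet_M bet_V bet_W]; [|lra].
  set (H := h (scale (total_variance l f))) in *.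
  pose proof (hedge_nonneg h Hh (x - fc_m f)).
  assert (0 <= h (x - fc_m f) / H) by (apply Rdiv_le_0_compat; lra).
  unfold Rdiv in *. lra.
Qed.

Definition h_term (f : nat -> forecast) (x : nat -> R) (n : nat) : R :=
  if Rlt_dec (exp 1) (A_seq f n) then h (dev f x n) / h (b_seq f n) else 0.

(** The budget to which every approximation error of a round is charged. *)
Definition error (f : nat -> forecast) (x : nat -> R) (n : nat) : R :=
  h_term f x n + w_term h f n.

Lemma b_seq_scale f n : b_seq f n = scale (var_sum f (S n)).
Proof. unfold b_seq. now rewrite A_seq_var_sum. Qed.

Lemma h_term_nonneg f x n : 0 <= h_term f x n.
Proof.
  unfold h_term. destruct Rlt_dec as [L|_]; [|lra]. rewrite b_seq_scale, A_seq_var_sum in *.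
  apply Rdiv_le_0_compat; [apply hedge_nonneg, Hh|]. apply (hedge_pos h Hh), scale_pos, L.
Qed.

Lemma w_term_nonneg f n : legal (f n) -> 0 <= w_term h f n.
Proof.
  intros [_ Hw]. unfold w_term. destruct Rlt_dec as [L|_]; [|lra].
  rewrite b_seq_scale, A_seq_var_sum in *.
  apply Rdiv_le_0_compat; [exact Hw|]. apply (hedge_pos h Hh), scale_pos, L.
Qed.

Lemma small_of_hedge_ratio y b eta : 0 < b -> 0 < eta <= 1 -> h y / h b < eta ^ 3 -> Rabs y <= eta * b.
Proof.
  intros Hb He Hy. apply Rnot_lt_le. intro L.
  assert (eta < Rabs y / b) by (apply Rlt_div_r; lra).
  assert (eta ^ 3 <= (Rabs y / b) ^ 3) by (apply pow_incr; lra).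
  assert (eta ^ 3 <= 1 ^ 3) by (apply pow_incr; lra).
  destruct (Rle_lt_dec (Rabs y) b) as [S|S].
  - pose proof (hedge_ratio_cubic h Hh y b Hb S). lra.
  - pose proof (hedge_ratio_quadratic h Hh y b Hb ltac:(lra)).
    assert (1 ^ 2 <= (Rabs y / b) ^ 2); [|lra].
    apply pow_incr. split; [lra|]. apply le_div; lra.
Qed.

(** The premise of the law, together with the duties of Forecaster. *)
Record regular_path (f : nat -> forecast) (x : nat -> R) : Prop := RegularPath {
  rp_legal : forall n, legal (f n);
  rp_coherent : forall n, coherent h (f n);
  rp_A : is_lim_seq (A_seq f) p_infty;
  rp_w : ex_series (w_term h f) }.

Lemma eventually_var_sum f x B : regular_path f x ->
  exists N, forall n, (N <= n)%nat -> B <= var_sum f n.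
Proof.
  intros R. pose proof (rp_A f x R) as L. apply is_lim_seq_spec in L.
  destruct (L B) as [N HN]. exists (S N). intros [|n] Hn; [lia|].
  rewrite <- A_seq_var_sum. left. apply HN. lia.
Qed.

Lemma eventually_scale f x B : regular_path f x ->
  exists N, forall n, (N <= n)%nat -> B <= scale (var_sum f n).
Proof.
  intros R.
  destruct (eventually_var_sum f x (exp (exp 1) + ((2 * B ^ 2) ^ 2)) R) as [N HN].
  exists N. intros n Hn. specialize (HN n Hn).
  pose proof (pow2_ge_0 (2 * B ^ 2)). pose proof (exp_pos (exp 1)).
  pose proof (sqrt_half_le (var_sum f n) ltac:(lra)) as S.
  apply Rle_trans with (sqrt (B ^ 2)).
  { rewrite <- pow2_abs, sqrt_pow2 by apply Rabs_pos. apply Rle_abs. }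
  unfold scale. apply sqrt_le_1_alt.
  enough (2 * B ^ 2 <= sqrt (var_sum f n)) by lra.
  rewrite <- (sqrt_pow2 (2 * B ^ 2)) by (pose proof (pow2_ge_0 B); lra).
  apply sqrt_le_1_alt. lra.
Qed.

Lemma eventually_hedge_scale f x B : regular_path f x ->
  exists N, forall n, (N <= n)%nat -> B <= h (scale (var_sum f n)).
Proof.
  intros R. destruct (hedge_unbounded h Hh B) as [b0 [_ Hb]].
  destruct (eventually_scale f x b0 R) as [N HN]. exists N. auto.
Qed.

Lemma w_term_partial_bound f x n : regular_path f x -> psum (w_term h f) n <= Series (w_term h f).
Proof.
  intros R. assert (P : forall i, 0 <= w_term h f i)
    by (intro; apply w_term_nonneg, (rp_legal f x R)).
  apply Rle_trans with (psum (w_term h f) (S n)); [apply psum_mono; [exact P|lia]|].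
  rewrite <- sum_f_R0_psum, <- sum_n_Reals.
  apply (is_lim_seq_incr_compare (sum_n (w_term h f))).
  - exact (Series_correct _ (rp_w f x R)).
  - intro i. rewrite sum_Sn. change (sum_n (w_term h f) i <= sum_n (w_term h f) i + w_term h f (S i)).
    specialize (P (S i)). lra.
Qed.

Lemma w_term_tail f x eta : regular_path f x -> 0 < eta ->
  exists N, forall n m, (N <= n)%nat -> (n <= m)%nat ->
    psum (w_term h f) m - psum (w_term h f) n <= eta.
Proof.
  intros R He. apply (psum_tail _ (Series (w_term h f))); [| |exact He].
  - intro i. apply w_term_nonneg, (rp_legal f x R).
  - intro n. now apply (w_term_partial_bound f x).
Qed.

(** From some round N on, each round multiplies the capital by
    1 + z - u >= (1 + z) exp (- 2 u), where z = h(y)/h(b) and u = w/h(b) <= 1/2. The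
    u are summable and a product of terms 1 + z dominates the sum of the z. *)
Lemma hedge_forces_summability f x C : regular_path f x ->
  (forall n, val hedge_martingale (past f x n) <= C) ->
  exists C', forall n, psum (h_term f x) n <= C'.
Proof.
  intros R HC.
  destruct (eventually_hedge_scale f x 1 R) as [N1 H1].
  destruct (eventually_var_sum f x (exp 1 + 1) R) as [N2 H2].
  destruct (w_term_tail f x (1 / 2) R ltac:(lra)) as [N3 H3].
  set (N := (N1 + N2 + N3)%nat).
  set (V := fun n => val hedge_martingale (past f x n)) in *.
  set (Z := psum (h_term f x)). set (U := psum (w_term h f)).
  assert (VN : 0 < V N) by apply val_pos.
  assert (Hstep : forall j, V N * exp (- (2 * (U (j + N)%nat - U N))) * (1 + (Z (j + N)%nat - Z N))
                            <= V (j + N)%nat).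
  { induction j as [|j IH].
    - cbn [Nat.add]. rewrite !Rminus_diag, Rmult_0_r, Ropp_0, exp_0. lra.
    - set (n := (j + N)%nat) in *.
      assert (Hu : 0 <= w_term h f n) by apply w_term_nonneg, (rp_legal f x R).
      assert (Hz := h_term_nonneg f x n).
      assert (Hu2 : w_term h f n <= 1 / 2).
      { specialize (H3 n (S n) ltac:(lia) ltac:(lia)). simpl in H3. lra. }
      assert (EV : V (S n) = V n * (1 + h_term f x n - w_term h f n)).
      { unfold V. cbn [past]. change (val hedge_martingale) with (product_val (h := h) hedge_rule).
        cbn [product_val]. f_equal. unfold hedge_rule.
        pose proof (H2 (S n) ltac:(lia)) as A2. pose proof (H1 (S n) ltac:(lia)) as A1.
        unfold h_term, w_term in *. rewrite b_seq_scale, A_seq_var_sum in *.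
        destruct (Rlt_dec (exp 1) (var_sum f (S n))) as [L|N']; [|lra].
        destruct excluded_middle_informative as [_|NC].
        - rewrite total_variance_past. unfold gain, dev, Rdiv; cbn [bet_M bet_V bet_W]. ring.
        - exfalso. apply NC. unfold hedge_condition. rewrite total_variance_past.
          repeat split; lra. }
      cbn [Nat.add]. fold n. rewrite EV.
      unfold Z, U. cbn [psum]. fold Z U.
      replace (- (2 * (U n + w_term h f n - U N))) with
        (- (2 * (U n - U N)) + - (2 * w_term h f n)) by ring.
      rewrite exp_plus.
      pose proof (exp_le_one_minus_double (w_term h f n) (conj Hu Hu2)) as E.
      assert (HZ : 0 <= Z n - Z N).
      { enough (Z N <= Z n) by lra. apply psum_mono; [apply h_term_nonneg|lia]. }
      set (u := w_term h f n) in *. set (z := h_term f x n) in *.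
      set (e1 := exp (- (2 * (U n - U N)))) in *. set (e2 := exp (- (2 * u))) in *.
      assert (P1 : 0 < e1) by apply exp_pos. assert (P2 : 0 < e2) by apply exp_pos.
      apply Rle_trans with ((V N * e1 * (1 + (Z n - Z N))) * (1 + z - u)).
      + replace (V N * (e1 * e2) * (1 + (Z n + z - Z N))) with
          (V N * e1 * (e2 * (1 + (Z n - Z N) + z))) by ring.
        rewrite (Rmult_assoc (V N * e1)).
        apply Rmult_le_compat_l; [nra|].
        apply Rle_trans with ((1 + (Z n - Z N)) * ((1 - u) * (1 + z))).
        * apply Rle_trans with (e2 * ((1 + (Z n - Z N)) * (1 + z))).
          -- apply Rmult_le_compat_l; [lra|]. nra.
          -- replace ((1 + (Z n - Z N)) * ((1 - u) * (1 + z))) with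
               ((1 - u) * ((1 + (Z n - Z N)) * (1 + z))) by ring.
             apply Rmult_le_compat_r; [nra|lra].
        * apply Rmult_le_compat_l; [lra|]. nra.
      + apply Rmult_le_compat_r; [lra|exact IH]. }
  exists (Z N + C / V N * exp 1).
  intro n. apply Rle_trans with (Z (n + N)%nat).
  { apply psum_mono; [apply h_term_nonneg|lia]. }
  specialize (Hstep n). specialize (HC (n + N)%nat).
  specialize (H3 N (n + N)%nat ltac:(lia) ltac:(lia)). fold U in H3.
  assert (exp (- 1) <= exp (- (2 * (U (n + N)%nat - U N)))) by (apply exp_mono; lra).
  assert (HZ : 0 <= Z (n + N)%nat - Z N).
  { enough (Z N <= Z (n + N)%nat) by lra. apply psum_mono; [apply h_term_nonneg|lia]. }
  set (D := Z (n + N)%nat - Z N) in *.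
  enough (D <= C / V N * exp 1) by (unfold D in *; lra).
  assert (B : V N * exp (-1) * D <= C).
  { apply Rle_trans with (2 := HC). apply Rle_trans with (2 := Hstep).
    apply Rle_trans with (V N * exp (-1) * (1 + D)).
    - apply Rmult_le_compat_l; [|lra]. pose proof (exp_pos (-1)). nra.
    - apply Rmult_le_compat_r; [lra|]. apply Rmult_le_compat_l; lra. }
  replace (C / V N * exp 1) with (C * exp 1 / V N) by (field; lra).
  apply le_div; [lra|].
  apply Rmult_le_compat_r with (r := exp 1) in B; [|left; apply exp_pos].
  replace (V N * exp (-1) * D * exp 1) with (D * V N * (exp (-1) * exp 1)) in B by ring.
  rewrite <- exp_plus in B. replace (-1 + 1) with 0 in B by ring. rewrite exp_0 in B. lra.
Qed.

(** What summability of the errors yields for a single late round; eta is as small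
    as desired, and [tame_tail] bounds all errors still to come. *)
Record tame (f : nat -> forecast) (x : nat -> R) (eta : R) (n : nat) : Prop := Tame {
  tame_A : exp (exp 1) <= var_sum f n;
  tame_dev : Rabs (dev f x n) <= eta * scale (var_sum f (S n));
  tame_v : sqrt (fc_v (f n)) <= eta * scale (var_sum f (S n));
  tame_dev3 : (Rabs (dev f x n) / scale (var_sum f (S n))) ^ 3 <= error f x n;
  tame_v3 : (sqrt (fc_v (f n)) / scale (var_sum f (S n))) ^ 3 <= 4 * error f x n;
  tame_w : fc_w (f n) / h (scale (var_sum f (S n))) <= eta;
  tame_gain : h (dev f x n) / h (scale (var_sum f (S n)))
      - fc_w (f n) / h (scale (var_sum f (S n))) >= - error f x n;
  tame_scale : / eta <= scale (var_sum f (S n));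
  tame_hscale : / eta <= h (scale (var_sum f (S n)));
  tame_tail : forall m, (n <= m)%nat -> psum (error f x) m - psum (error f x) n <= eta }.

Lemma error_nonneg f x n : regular_path f x -> 0 <= error f x n.
Proof.
  intros R. pose proof (h_term_nonneg f x n).
  pose proof (w_term_nonneg f n (rp_legal f x R n)). unfold error. lra.
Qed.

(** Small errors mean h(y)/h(b) and h(sqrt v)/h(b) < eta^3, and h being at most
    cubic turns this into |y|, sqrt v <= eta b. *)
Lemma eventually_tame f x C eta : regular_path f x -> (forall n, psum (h_term f x) n <= C) ->
  0 < eta <= 1 -> exists N, forall n, (N <= n)%nat -> tame f x eta n.
Proof.
  intros R HC He.
  assert (He3 : 0 < eta ^ 3) by (apply pow_lt; lra).
  assert (Hle : eta ^ 3 <= eta) by nra.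
  (* 4 times the error bounds h(sqrt v)/h(b), which has to be below eta^3: hence the 5. *)
  destruct (psum_tail (error f x) (C + Series (w_term h f))) with (eta := eta ^ 3 / 5) as [N0 H0].
  { intro i. now apply error_nonneg. }
  { intro n. unfold error. rewrite psum_plus. apply Rplus_le_compat; [apply HC|].
    now apply (w_term_partial_bound f x). }
  { lra. }
  destruct (eventually_scale f x (/ eta) R) as [N1 H1].
  destruct (eventually_hedge_scale f x (/ eta) R) as [N2 H2].
  destruct (eventually_var_sum f x (exp (exp 1)) R) as [N3 H3].
  exists (N0 + N1 + N2 + N3)%nat. intros n Hn.
  pose proof (H0 n (S n) ltac:(lia) ltac:(lia)) as Ee. cbn [psum] in Ee.
  pose proof (h_term_nonneg f x n) as Hz.
  pose proof (w_term_nonneg f n (rp_legal f x R n)) as Hw.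
  pose proof (H3 (S n) ltac:(lia)) as HA.
  pose proof (coherent_hedge_bound h Hh (f n) (rp_legal f x R n) (rp_coherent f x R n)) as Hv.
  assert (HA' : exp 1 < var_sum f (S n)).
  { pose proof (exp_ineq1 (exp 1)). pose proof (exp_pos 1). lra. }
  assert (Hb := scale_pos _ HA').
  assert (Hhb := hedge_pos h Hh _ Hb).
  assert (Ez : h_term f x n = h (dev f x n) / h (scale (var_sum f (S n)))).
  { unfold h_term. rewrite b_seq_scale, A_seq_var_sum. destruct Rlt_dec; [reflexivity|lra]. }
  assert (Ew : w_term h f n = fc_w (f n) / h (scale (var_sum f (S n)))).
  { unfold w_term. rewrite b_seq_scale, A_seq_var_sum. destruct Rlt_dec; [reflexivity|lra]. }
  set (b := scale (var_sum f (S n))) in *.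
  assert (Hv' : h (sqrt (fc_v (f n))) / h b <= 4 * w_term h f n).
  { rewrite Ew. apply div_le; [lra|]. unfold Rdiv. rewrite !Rmult_assoc, Rinv_l, Rmult_1_r; lra. }
  assert (D1 : Rabs (dev f x n) <= eta * b).
  { apply small_of_hedge_ratio; [lra|lra|]. unfold error in Ee. lra. }
  assert (D2 : Rabs (sqrt (fc_v (f n))) <= eta * b).
  { apply small_of_hedge_ratio; [lra|lra|]. unfold error in Ee. lra. }
  assert (eta * b <= b) by nra.
  pose proof (sqrt_pos (fc_v (f n))) as Sp.
  pose proof (hedge_ratio_cubic h Hh (dev f x n) b Hb ltac:(lra)) as C1.
  pose proof (hedge_ratio_cubic h Hh (sqrt (fc_v (f n))) b Hb ltac:(lra)) as C2.
  rewrite Rabs_pos_eq in D2, C2 by exact Sp.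
  split; fold b; unfold error in *.
  - apply H3. lia.
  - exact D1.
  - exact D2.
  - lra.
  - lra.
  - lra.
  - lra.
  - apply H1. lia.
  - apply H2. lia.
  - intros m Hm. pose proof (H0 n m ltac:(lia) Hm) as X. apply Rle_trans with (1 := X). lra.
Qed.

(** If |lambda| b <= theta, the cubes |lambda y|^3 and (|lambda| sqrt v)^3 left over by
    [factor_lower] and [factor_upper] are at most theta^3 times the error of the round,
    up to a constant. *)
Lemma tilt_factor_bounds f x eta n lam theta : regular_path f x -> tame f x eta n ->
  Rabs lam * scale (var_sum f (S n)) <= theta -> eta * theta <= 1 / 2 -> 0 <= eta ->
  let q := lam * dev f x n - lam ^ 2 * fc_v (f n) / 2 in
  let e := 13 * theta ^ 3 * error f x n in
  exp (q - e) <= 1 + lam * dev f x n + lam ^ 2 / 2 * (dev f x n ^ 2 - fc_v (f n)) <= exp (q + e).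
Proof.
  intros R T Hth Het He0 q e.
  destruct (rp_legal f x R n) as [Hv _].
  assert (Eb := error_nonneg f x n R).
  pose proof (tame_dev _ _ _ _ T) as Hy. pose proof (tame_v _ _ _ _ T) as Hr.
  pose proof (tame_dev3 _ _ _ _ T) as Hy3. pose proof (tame_v3 _ _ _ _ T) as Hr3.
  pose proof (tame_A _ _ _ _ T) as HA.
  assert (Hb : 0 < scale (var_sum f (S n))).
  { apply scale_pos. pose proof (exp_ineq1 (exp 1)). pose proof (exp_pos 1).
    unfold var_sum in *. cbn [psum]. lra. }
  set (b := scale (var_sum f (S n))) in *. set (y := dev f x n) in *. set (v := fc_v (f n)) in *.
  pose proof (Rabs_pos lam) as Hl. pose proof (sqrt_pos v) as Sp.
  assert (Hth0 : 0 <= theta) by nra.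
  set (r := Rabs lam * sqrt v).
  assert (Er : r ^ 2 = lam ^ 2 * v).
  { unfold r. rewrite Rpow_mult_distr, pow2_abs, pow2_sqrt by exact Hv. reflexivity. }
  assert (small : forall s, 0 <= s -> s <= eta * b -> Rabs lam * s <= 1 / 2).
  { intros s Hs Hsb. apply Rle_trans with (2 := Het).
    apply Rle_trans with (Rabs lam * (eta * b)); [apply Rmult_le_compat_l; lra|].
    replace (Rabs lam * (eta * b)) with (eta * (Rabs lam * b)) by ring.
    apply Rmult_le_compat_l; lra. }
  assert (cube : forall s E, 0 <= s -> (s / b) ^ 3 <= E -> (Rabs lam * s) ^ 3 <= theta ^ 3 * E).
  { intros s E Hs HE. replace ((Rabs lam * s) ^ 3) with ((Rabs lam * b) ^ 3 * (s / b) ^ 3) by (field; lra).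
    apply Rmult_le_compat; [apply pow_le; nra| |apply pow_incr; nra|exact HE].
    apply pow_le, Rdiv_le_0_compat; lra. }
  assert (Hu : Rabs (lam * y) <= 1 / 2) by (rewrite Rabs_mult; apply small; [apply Rabs_pos|exact Hy]).
  assert (Hr2 : 0 <= r <= 1 / 2) by (split; [unfold r; nra|apply small; assumption]).
  assert (Hu3 : Rabs (lam * y) ^ 3 <= theta ^ 3 * error f x n)
    by (rewrite Rabs_mult; apply cube; [apply Rabs_pos|exact Hy3]).
  assert (Hr3' : r ^ 3 <= theta ^ 3 * (4 * error f x n)) by (apply cube; assumption).
  assert (T0 : 0 <= theta ^ 3 * error f x n) by (apply Rmult_le_pos; [apply pow_le; lra|lra]).
  replace (1 + lam * y + lam ^ 2 / 2 * (y ^ 2 - v)) with (factor (lam * y) r)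
    by (unfold factor; rewrite Er; field).
  unfold q, e. split.
  - apply Rle_trans with (2 := factor_lower (lam * y) r Hu Hr2). apply exp_mono. rewrite Er.
    enough (5 * Rabs (lam * y) ^ 3 + 2 * r ^ 3 <= 13 * (theta ^ 3 * error f x n)) by lra. lra.
  - apply Rle_trans with (1 := factor_upper (lam * y) r ltac:(lra) (proj1 Hr2)). apply exp_mono. rewrite Er.
    lra.
Qed.

End SmallMoves.

(** * The upper bound *)

(** Telescoping differences sum to exactly 1 and are of order k^(-1-s). *)
Definition telescope_weight (s : R) (k : nat) : R :=
  Rpower (INR (S k)) (- s) - Rpower (INR (S (S k))) (- s).

Lemma telescope_weight_lower s k : 0 < s ->
  s * exp (- ((1 + s) * ln (INR (S (S k))))) <= telescope_weight s k.
Proof.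
  intros Hs. unfold telescope_weight, Rpower.
  set (a := INR (S k)). set (b := INR (S (S k))).
  assert (Ha : 0 < a) by (apply lt_0_INR; lia).
  assert (Hb : b = a + 1) by (unfold a, b; now rewrite !S_INR).
  assert (L : / b <= ln b - ln a).
  { assert (ln (a / b) <= a / b - 1) by (apply ln_le_pred, Rdiv_lt_0_compat; lra).
    rewrite ln_div in H by lra. replace (a / b - 1) with (- / b) in H by (rewrite Hb; field; lra). lra. }
  replace (- s * ln a) with (- s * ln b + s * (ln b - ln a)) by ring.
  rewrite exp_plus. pose proof (exp_ineq1_le (s * (ln b - ln a))) as E.
  assert (P := exp_pos (- s * ln b)).
  replace (- ((1 + s) * ln b)) with (- s * ln b + - ln b) by ring.
  rewrite exp_plus, exp_Ropp, exp_ln by lra.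
  assert (s * / b <= exp (s * (ln b - ln a)) - 1).
  { apply Rmult_le_compat_l with (r := s) in L; lra. }
  apply Rmult_le_compat_l with (r := exp (- s * ln b)) in H; lra.
Qed.

Lemma telescope_weight_pos s k : 0 < s -> 0 < telescope_weight s k.
Proof.
  intros Hs. apply Rlt_le_trans with (2 := telescope_weight_lower s k Hs).
  apply Rmult_lt_0_compat; [lra|apply exp_pos].
Qed.

Lemma telescope_weight_sum s : 0 < s -> is_series (telescope_weight s) 1.
Proof.
  intros Hs.
  assert (E : forall n, 1 - Rpower (INR (S (S n))) (- s) = sum_n (telescope_weight s) n).
  { induction n as [|n IH].
    - rewrite sum_O. unfold telescope_weight. replace (INR 1) with 1 by reflexivity.
      unfold Rpower. now rewrite ln_1, Rmult_0_r, exp_0.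
    - rewrite sum_Sn, <- IH. unfold telescope_weight, plus; simpl plus. cbn -[INR]. ring. }
  change (is_lim_seq (sum_n (telescope_weight s)) 1).
  apply (is_lim_seq_ext _ _ _ E).
  replace (Finite 1) with (Finite (1 - 0)) by (f_equal; ring).
  apply is_lim_seq_minus'; [apply is_lim_seq_const|].
  apply is_lim_seq_spec. intro eps. cbv beta.
  destruct (INR_unbounded (exp (- ln eps / s))) as [N HN]. exists N. intros n Hn.
  assert (Hb : exp (- ln eps / s) < INR (S (S n))).
  { apply Rlt_le_trans with (1 := HN). apply le_INR. lia. }
  rewrite Rminus_0_r. unfold Rpower. rewrite Rabs_pos_eq by (left; apply exp_pos).
  rewrite <- (exp_ln eps) by apply cond_pos. apply exp_increasing.
  apply ln_increasing in Hb; [|apply exp_pos]. rewrite ln_exp in Hb.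
  apply (Rlt_div_l _ _ _ Hs) in Hb. lra.
Qed.

Section Tilt.
Context (h : R -> R).

(** The condition on v makes every factor at least 3/8, whatever the outcome; this
    also bounds the damage done by the finitely many rounds that are not tame. *)
Definition tilt_rule (lam : R) (l : list (forecast * R)) (f : forecast) : bet :=
  if excluded_middle_informative (Rabs lam <= 1 /\ lam ^ 2 * fc_v f <= 1 / 4)
  then Bet lam (lam ^ 2 / 2) 0 else Bet 0 0 0.

Lemma tilt_rule_gain lam l f x : 3 / 8 <= 1 + gain h f (tilt_rule lam l f) x.
Proof.
  unfold tilt_rule. destruct excluded_middle_informative as [[_ C]|_];
    unfold gain; cbn [bet_M bet_V bet_W]; [|lra].
  pose proof (pow2_ge_0 (lam * (x - fc_m f) + 1)). lra.
Qed.

Program Definition tilt_martingale (lam : R) : martingale h := multiplicative (tilt_rule lam) _ _.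
Next Obligation.
  unfold tilt_rule. destruct excluded_middle_informative as [[C _]|_];
    cbn [bet_M bet_V bet_W]; rewrite ?Rabs_R0; repeat split; try lra.
  unfold Rdiv. rewrite Rabs_mult, <- RPow_abs, (Rabs_pos_eq (/ 2)) by lra.
  assert (Rabs lam ^ 2 <= 1 ^ 2) by (apply pow_incr; split; [apply Rabs_pos|exact C]). lra.
Qed.
Next Obligation. pose proof (tilt_rule_gain lam l f x). lra. Qed.

Lemma tilt_martingale_lower lam f x n : (3 / 8) ^ n <= val (tilt_martingale lam) (past f x n).
Proof.
  induction n as [|n IH]; [simpl; lra|].
  change (val (tilt_martingale lam)) with (product_val (h := h) (tilt_rule lam)) in *.
  cbn [past product_val pow].
  rewrite Rmult_comm.
  apply Rmult_le_compat; [apply pow_le; lra|lra|exact IH|apply tilt_rule_gain].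
Qed.

Lemma tilt_growth (Hh : hedge h) f x eta N theta lam n :
  regular_path h f x -> 0 <= eta -> eta * theta <= 1 / 2 -> Rabs lam <= 1 ->
  (forall i, (N <= i)%nat -> tame h f x eta i) -> (N <= n)%nat ->
  (forall i, (N <= i < n)%nat -> Rabs lam * scale (var_sum f (S i)) <= theta) ->
  (3 / 8) ^ N * exp (lam * (dev_sum f x n - dev_sum f x N) - lam ^ 2 * (var_sum f n - var_sum f N) / 2
         - 13 * theta ^ 3 * (psum (error h f x) n - psum (error h f x) N))
  <= val (tilt_martingale lam) (past f x n).
Proof.
  intros R He Het Hl HT Hn. induction Hn as [|n Hn IH]; intros Hs.
  - rewrite !Rminus_diag, !Rmult_0_r. unfold Rdiv. rewrite Rmult_0_l, !Rminus_0_r, exp_0, Rmult_1_r.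
    apply tilt_martingale_lower.
  - specialize (IH (fun i Hi => Hs i ltac:(lia))).
    assert (Hsn := Hs n ltac:(lia)). assert (T := HT n Hn).
    pose proof (tilt_factor_bounds h Hh f x eta n lam theta R T Hsn Het He) as [F _].
    destruct (rp_legal _ _ _ R n) as [Hv _].
    change (val (tilt_martingale lam)) with (product_val (h := h) (tilt_rule lam)) in *.
    cbn [past product_val].
    unfold dev_sum, var_sum. cbn [psum].
    fold (dev_sum f x n) (dev_sum f x N) (var_sum f n) (var_sum f N).
    match goal with |- _ * exp ?A <= ?V * _ =>
      match type of IH with _ * exp ?B <= _ => match type of F with exp ?C <= _ =>
        replace A with (B + C) by (unfold dev; field) end end end.
    rewrite exp_plus, <- Rmult_assoc. apply Rmult_le_compat.
    + apply Rmult_le_pos; [apply pow_le; lra|left; apply exp_pos].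
    + left; apply exp_pos.
    + exact IH.
    + apply Rle_trans with (1 := F). right.
      unfold tilt_rule. destruct excluded_middle_informative as [_|C].
      * unfold gain, dev; cbn [bet_M bet_V bet_W]. ring.
      * exfalso. apply C. split; [exact Hl|].
        assert (K : Rabs lam * sqrt (fc_v (f n)) <= 1 / 2).
        { pose proof (tame_v _ _ _ _ _ T). pose proof (Rabs_pos lam).
          apply Rle_trans with (2 := Het).
          apply Rle_trans with (Rabs lam * (eta * scale (var_sum f (S n)))); [apply Rmult_le_compat_l; lra|].
          replace (Rabs lam * (eta * scale (var_sum f (S n))))
            with (eta * (Rabs lam * scale (var_sum f (S n)))) by ring.
          apply Rmult_le_compat_l; lra. }
        replace (lam ^ 2 * fc_v (f n)) with ((Rabs lam * sqrt (fc_v (f n))) ^ 2)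
          by (rewrite Rpow_mult_distr, pow2_abs, pow2_sqrt by exact Hv; reflexivity).
        replace (1 / 4) with ((1 / 2) ^ 2) by field. apply pow_incr. split; [|exact K].
        apply Rmult_le_pos; [apply Rabs_pos|apply sqrt_pos].
Qed.

(** The lambda that maximises lambda S - lambda^2 B / 2 at S = sqrt (2 B lnln B). *)
Definition tilt (B : R) : R := sqrt (2 * ln (ln B) / B).

Lemma tilt_sqr B : exp (exp 1) <= B -> tilt B ^ 2 = 2 * ln (ln B) / B.
Proof.
  intros H. pose proof (lnln_ge_1 B H). pose proof (exp_pos (exp 1)).
  apply pow2_sqrt, Rdiv_le_0_compat; lra.
Qed.

Lemma tilt_le_1 B : exp (exp 1) <= B -> tilt B <= 1.
Proof.
  intros H. pose proof (ln_ge_exp1 B H). pose proof (exp_pos (exp 1)). pose proof (exp_pos 1).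
  unfold tilt. rewrite <- sqrt_1. apply sqrt_le_1_alt. apply div_le; [lra|].
  assert (S := sqrt_lt_R0 B ltac:(lra)).
  assert (E1 : ln (ln B) <= ln B - 1) by (apply ln_le_pred; lra).
  assert (E2 : ln B <= 2 * (sqrt B - 1)).
  { replace (ln B) with (ln (sqrt B * sqrt B)) by (now rewrite sqrt_sqrt by lra).
    rewrite ln_mult by lra. pose proof (ln_le_pred (sqrt B) S). lra. }
  assert (E3 := sqrt_sqrt B ltac:(lra)). pose proof (pow2_ge_0 (sqrt B - 2)). nra.
Qed.

(** lnln A / A decreases, so a tilt chosen for the block of a is of order 1/b at all
    earlier rounds. *)
Lemma tilt_mult_scale B A a c : exp (exp 1) <= B -> B <= a -> a <= c * B ->
  exp (exp 1) <= A -> A <= a -> tilt B * scale A <= sqrt (2 * c).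
Proof.
  intros HB HBa Hac HA HAa. pose proof (exp_pos (exp 1)).
  pose proof (lnln_ge_1 B HB). pose proof (lnln_ge_1 A HA).
  pose proof (lnln_mono B a HB HBa). pose proof (lnln_div_antitone A a HA HAa) as M.
  unfold tilt, scale. rewrite <- sqrt_mult_alt by (apply Rdiv_le_0_compat; lra).
  apply sqrt_le_1_alt.
  apply (le_mult_of_div_le (ln (ln a)) _ a) in M; [|lra].
  assert (Q : ln (ln a) * (A / ln (ln A)) <= a).
  { replace a with (ln (ln A) / A * a * (A / ln (ln A))) at 2 by (field; lra).
    apply Rmult_le_compat_r; [apply Rdiv_le_0_compat; lra|exact M]. }
  apply Rle_trans with (2 * (ln (ln a) * (A / ln (ln A))) / B).
  - replace (2 * ln (ln B) / B * (A / ln (ln A))) with (2 * (ln (ln B) * (A / ln (ln A))) / B) by (field; lra).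
    apply Rmult_le_compat_r; [left; apply Rinv_0_lt_compat; lra|].
    apply Rmult_le_compat_l; [lra|]. apply Rmult_le_compat_r; [apply Rdiv_le_0_compat; lra|lra].
  - apply div_le; [lra|]. nra.
Qed.

Lemma half_pos eps : 0 < eps -> 0 < eps / 2.
Proof. lra. Qed.

Definition upper_martingale (eps : R) (Heps : 0 < eps) (sigma : R) : martingale h :=
  mixture (telescope_weight (eps / 2)) (fun k => telescope_weight_pos _ k (half_pos _ Heps))
    (telescope_weight_sum _ (half_pos _ Heps))
    (fun k => tilt_martingale (sigma * tilt ((1 + eps) ^ k))).

Lemma eventually_block f x rho K : regular_path h f x -> 1 < rho ->
  exists N, forall n, (N <= n)%nat -> 1 <= var_sum f n /\ (K <= block rho (var_sum f n))%nat.
Proof.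
  intros R Hr. destruct (eventually_var_sum h f x (rho ^ K) R) as [N HN].
  exists N. intros n Hn. specialize (HN n Hn).
  assert (1 <= rho ^ K) by (apply pow_R1_Rle; lra). split; [lra|].
  destruct (block_spec rho (var_sum f n) Hr ltac:(lra)) as [_ B].
  assert ((K < S (block rho (var_sum f n)))%nat) by (apply (pow_lt_inv rho); lra). lia.
Qed.

(** Were the bound violated with A_n in block k, the exponent lambda S - lambda^2 A / 2
    would be at least (2 (1+eps) - rho) lnln rho^k = (1+eps) lnln rho^k up to a
    constant, where rho = 1 + eps. The k-th component is then of order k^(1+eps), and
    its share in the mixture of order k^(eps/2). *)
Lemma upper_bound (Hh : hedge h) f x C C' eps (Heps : 0 < eps) sigma :
  regular_path h f x -> eps <= 1 -> sigma = 1 \/ sigma = -1 ->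
  (forall n, psum (h_term h f x) n <= C') ->
  (forall n, val (upper_martingale eps Heps sigma) (past f x n) <= C) ->
  exists N, forall n, (N <= n)%nat ->
    sigma * dev_sum f x n <= (1 + eps) * sqrt (2 * var_sum f n * ln (ln (var_sum f n))).
Proof.
  intros R He1 Hsig HC' HC.
  destruct (eventually_tame h Hh f x C' (1 / 4) R HC' ltac:(lra)) as [N0 T].
  set (rho := 1 + eps) in *. assert (Hrho : 1 < rho <= 2) by (unfold rho; lra).
  destruct (Pow_x_infinity rho ltac:(rewrite Rabs_pos_eq; lra) (exp (exp 1))) as [K1 HK1].
  (* 26 = 13 * 2^3 / 4 bounds the errors after N0, and c2 collects eps/2 and the factors before N0. *)
  set (c1 := Rabs (dev_sum f x N0) + 26).
  set (c2 := eps / 2 * (3 / 8) ^ N0).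
  assert (Hc2 : 0 < c2) by (apply Rmult_lt_0_compat; [lra|apply pow_lt; lra]).
  set (c3 := c1 - (1 + eps) * ln (ln rho) + (1 + eps / 2) * ln 3).
  destruct (INR_unbounded (exp ((C / c2 + c3) * 2 / eps))) as [K2 HK2].
  destruct (eventually_block f x rho (S (K1 + K2)) R (proj1 Hrho)) as [N1 HN1].
  exists (N0 + N1)%nat. intros n Hn. apply Rnot_lt_le. intro Hbig.
  destruct (HN1 n ltac:(lia)) as [Ha1 Hk]. set (a := var_sum f n) in *.
  destruct (block_spec rho a (proj1 Hrho) Ha1) as [Hk1 Hk2].
  set (k := block rho a) in *. set (B := rho ^ k) in *.
  assert (HB : exp (exp 1) <= B).
  { specialize (HK1 k ltac:(lia)). unfold B. rewrite Rabs_pos_eq in HK1 by (apply pow_le; lra). lra. }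
  pose proof (exp_pos (exp 1)). pose proof (lnln_ge_1 B HB) as Hl. pose proof (lnln_mono B a HB Hk1) as Hla.
  set (lam := tilt B). assert (Hlam0 : 0 <= lam) by apply sqrt_pos.
  assert (Hlam1 := tilt_le_1 B HB). fold lam in Hlam1.
  assert (Habs : Rabs (sigma * lam) = lam).
  { rewrite Rabs_mult, (Rabs_pos_eq lam) by lra.
    destruct Hsig as [-> | ->]; [rewrite Rabs_R1|rewrite Rabs_left by lra]; ring. }
  assert (Hsig2 : (sigma * lam) ^ 2 = lam ^ 2) by (destruct Hsig as [-> | ->]; ring).
  assert (Hmono : forall i j, (i <= j)%nat -> var_sum f i <= var_sum f j).
  { apply psum_mono. intro i. apply (rp_legal _ _ _ R i). }
  assert (HaB : a <= rho * B) by (unfold B; simpl in Hk2; lra).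
  pose proof (tilt_growth Hh f x (1 / 4) N0 2 (sigma * lam) n R ltac:(lra) ltac:(lra)
    ltac:(rewrite Habs; lra) T ltac:(lia)) as G.
  assert (Gs : forall i, (N0 <= i < n)%nat -> Rabs (sigma * lam) * scale (var_sum f (S i)) <= 2).
  { intros i Hi. rewrite Habs. apply Rle_trans with (sqrt (2 * rho)).
    - apply (tilt_mult_scale B _ a); try assumption.
      + apply Rle_trans with (var_sum f i); [apply (tame_A _ _ _ _ _ (T i ltac:(lia)))|apply Hmono; lia].
      + apply Hmono. lia.
    - replace 2 with (sqrt 4) at 2 by (replace 4 with (2 ^ 2) by ring; apply sqrt_pow2; lra).
      apply sqrt_le_1_alt. lra. }
  specialize (G Gs). rewrite Hsig2 in G.
  assert (Tl := tame_tail _ _ _ _ _ (T N0 (Nat.le_refl _)) n ltac:(lia)).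
  pose proof (component_le_mixture _ (fun k => telescope_weight_pos _ k (half_pos _ Heps))
    (telescope_weight_sum _ (half_pos _ Heps))
    (fun k => tilt_martingale (sigma * tilt ((1 + eps) ^ k))) k (past f x n)) as D.
  fold (upper_martingale eps Heps sigma) in D. cbv beta in D. fold rho in D. fold B in D. fold lam in D.
  assert (G2 := Rle_trans _ _ _ G D). clear G D.
  set (p := telescope_weight (eps / 2) k) in *.
  assert (Pp : 0 < p) by apply telescope_weight_pos, half_pos, Heps.
  apply (mult_le_of_le_div _ _ _ Pp) in G2.
  assert (G3 := Rle_trans _ _ _ G2 (HC n)). clear G2.
  assert (Hl2 : lam ^ 2 = 2 * ln (ln B) / B) by (apply tilt_sqr, HB).
  assert (E1 : 2 * ln (ln B) <= lam * sqrt (2 * a * ln (ln a))).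
  { unfold lam, tilt. rewrite <- sqrt_mult_alt by (apply Rdiv_le_0_compat; lra).
    rewrite <- (sqrt_pow2 (2 * ln (ln B))) at 1 by lra. apply sqrt_le_1_alt.
    replace (2 * ln (ln B) / B * (2 * a * ln (ln a))) with
      (2 * ln (ln B) * (2 * ln (ln a)) * a / B) by (field; lra).
    apply le_div; [lra|].
    apply Rmult_le_compat; [apply pow2_ge_0|lra| |exact Hk1].
    rewrite <- Rsqr_pow2. unfold Rsqr. apply Rmult_le_compat_l; lra. }
  assert (E2 : lam ^ 2 * a / 2 <= rho * ln (ln B)).
  { rewrite Hl2. replace (2 * ln (ln B) / B * a / 2) with (ln (ln B) * a / B) by (field; lra).
    apply div_le; [lra|]. nra. }
  assert (E3 : (1 + eps) * (2 * ln (ln B)) <= sigma * lam * dev_sum f x n).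
  { apply Rle_trans with (lam * ((1 + eps) * sqrt (2 * a * ln (ln a)))).
    - replace (lam * ((1 + eps) * sqrt (2 * a * ln (ln a)))) with
       ((1 + eps) * (lam * sqrt (2 * a * ln (ln a)))) by ring. apply Rmult_le_compat_l; lra.
    - replace (sigma * lam * dev_sum f x n) with (lam * (sigma * dev_sum f x n)) by ring.
      apply Rmult_le_compat_l; [lra|]. fold rho. lra. }
  assert (E4 : sigma * lam * dev_sum f x N0 <= Rabs (dev_sum f x N0)).
  { apply Rle_trans with (1 := Rle_abs _). rewrite Rabs_mult, Habs.
    rewrite <- (Rmult_1_l (Rabs (dev_sum f x N0))) at 2. apply Rmult_le_compat_r; [apply Rabs_pos|lra]. }
  assert (E5 : 0 <= var_sum f N0).
  { apply (Hmono 0%nat). lia. }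
  assert (E6 : 0 <= lam ^ 2 * var_sum f N0 / 2).
  { pose proof (pow2_ge_0 lam). apply Rdiv_le_0_compat; [nra|lra]. }
  assert (Ek : ln (ln B) = ln (INR k) + ln (ln rho)) by (apply ln_ln_pow; [lra|lia]).
  assert (Kpos : 1 <= INR k) by (replace 1 with (INR 1) by reflexivity; apply le_INR; lia).
  assert (Elk : ln (INR (S (S k))) <= ln (INR k) + ln 3).
  { rewrite <- ln_mult by lra. apply ln_mono; [apply lt_0_INR; lia|]. rewrite !S_INR. lra. }
  assert (Pl := telescope_weight_lower (eps / 2) k (half_pos _ Heps)). fold p in Pl.
  set (ex := exp (eps / 2 * ln (INR k) - c3)).
  assert (Hex : c2 * ex <= C).
  { apply Rle_trans with (2 := G3). unfold c2.
    replace (eps / 2 * (3 / 8) ^ N0 * ex) with ((3 / 8) ^ N0 * (ex * (eps / 2))) by ring.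
    rewrite Rmult_assoc. apply Rmult_le_compat_l; [apply pow_le; lra|].
    match goal with |- _ <= exp ?A * p => set (q := A) in * end.
    apply Rle_trans with (exp q * (eps / 2 * exp (- ((1 + eps / 2) * ln (INR (S (S k))))))).
    - replace (exp q * (eps / 2 * exp (- ((1 + eps / 2) * ln (INR (S (S k)))))))
        with (exp q * exp (- ((1 + eps / 2) * ln (INR (S (S k))))) * (eps / 2)) by ring.
      apply Rmult_le_compat_r; [lra|]. rewrite <- exp_plus. apply exp_mono.
      unfold q, c3, c1.
      assert ((1 + eps / 2) * ln (INR (S (S k))) <= (1 + eps / 2) * (ln (INR k) + ln 3))
        by (apply Rmult_le_compat_l; lra).
      rewrite Rmult_minus_distr_l. fold a.
      replace (lam ^ 2 * (a - var_sum f N0) / 2) with (lam ^ 2 * a / 2 - lam ^ 2 * var_sum f N0 / 2) by field.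
      unfold rho in E2. rewrite Ek in E2, E3. lra.
    - apply Rmult_le_compat_l; [left; apply exp_pos|exact Pl]. }
  pose proof (exp_ineq1_le (eps / 2 * ln (INR k) - c3)) as X. fold ex in X.
  assert (Y : C / c2 + c3 < eps / 2 * ln (INR k)).
  { assert (exp ((C / c2 + c3) * 2 / eps) < INR k).
    { apply Rlt_le_trans with (1 := HK2). apply le_INR. lia. }
    apply ln_increasing in H0; [|apply exp_pos]. rewrite ln_exp in H0.
    apply Rmult_lt_compat_r with (r := eps / 2) in H0; [|lra].
    replace ((C / c2 + c3) * 2 / eps * (eps / 2)) with (C / c2 + c3) in H0 by (field; lra). lra. }
  assert (C / c2 < ex) by lra.
  apply (Rlt_div_l _ _ _ Hc2) in H0. lra.
Qed.

End Tilt.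

(** * The short position in a block *)

(** Within a block: the value [bk_L] of the exponential process sold short, the
    capital [bk_base] at the start of the block, and the current capital. *)
Record book := Book { bk_L : R; bk_base : R; bk_cap : R }.

(** Number of h-tickets per unit of base capital, each scaled by 1/h(b). They must cover
    (46 t + 1058 t^2)/2 at t = |y|/b > 1/400, where h(y)/h(b) >= t^2/400 and
    t <= 400 t^2. *)
Definition premium : R := 4000000.

Section Short.
Context (h : R -> R) (Hh : hedge h) (rho : R).

(** The factor 32 makes the end of the block favourable: see
    [exponent_end_of_block]. *)
Definition steep (k : nat) : R := 32 * tilt (rho ^ S k).

(** Trade only while the position is sound: half of the base capital is left, L is at
    most k+1, the tilt is of order 1/b, and the tickets are cheap. Any single round
    then costs at most a quarter of the base. *)
Definition short_condition (s : book) (k : nat) (A : R) (f : forecast) : Prop :=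
  (bk_base s / 2 <= bk_cap s /\ bk_L s <= INR (S k)) /\
  (steep k * scale A <= 46 /\ steep k <= 1) /\
  (0 <= fc_v f /\ steep k ^ 2 * fc_v f <= 1 / 4) /\
  exp 1 < A /\ 2 * premium <= h (scale A) /\ premium * (fc_w f / h (scale A)) <= 1 / 8.

Definition short_bet (s : book) (k : nat) (A : R) (f : forecast) : bet :=
  if excluded_middle_informative (short_condition s k A f)
  then Bet (bk_base s * - (bk_L s / (2 * INR (S k)) * steep k))
           (bk_base s * - (bk_L s / (2 * INR (S k)) * (steep k ^ 2 / 2)))
           (bk_base s * (premium / h (scale A)))
  else Bet 0 0 0.

Definition tilt_step (lam : R) (f : forecast) (x : R) : R :=
  1 + lam * (x - fc_m f) + lam ^ 2 / 2 * ((x - fc_m f) ^ 2 - fc_v f).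

Definition short_update (s : book) (k : nat) (A : R) (f : forecast) (x : R) : book :=
  Book (if excluded_middle_informative (short_condition s k A f)
        then bk_L s * tilt_step (steep k) f x else bk_L s)
       (bk_base s) (bk_cap s + gain h f (short_bet s k A f) x).

(** Entering a new block closes the position and sells a fresh one. *)
Definition reopen (s : book) (A A' : R) : book :=
  if Nat.eq_dec (block rho A) (block rho A') then s else Book 1 (bk_cap s) (bk_cap s).

Fixpoint book_of (l : list (forecast * R)) : book :=
  match l with
  | nil => Book 1 1 1
  | (f, x) :: l' =>
      short_update (reopen (book_of l') (variance l') (total_variance l' f))
        (block rho (total_variance l' f)) (total_variance l' f) f x
  end.

Definition sound (s : book) : Prop := 0 < bk_L s /\ 0 < bk_base s /\ bk_base s / 4 <= bk_cap s.

Lemma sound_reopen s A A' : sound s -> sound (reopen s A A').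
Proof.
  intros [H1 [H2 H3]]. unfold reopen. destruct Nat.eq_dec; [now repeat split|].
  repeat split; simpl; lra.
Qed.

Lemma steep_nonneg k : 0 <= steep k.
Proof. unfold steep, tilt. pose proof (sqrt_pos (2 * ln (ln (rho ^ S k)) / rho ^ S k)). lra. Qed.

Lemma short_gain s k A f x : short_condition s k A f ->
  gain h f (short_bet s k A f) x = bk_base s *
    (bk_L s / (2 * INR (S k)) * (1 - tilt_step (steep k) f x)
     + premium * (h (x - fc_m f) / h (scale A) - fc_w f / h (scale A))).
Proof.
  intros Hc. unfold short_bet. destruct excluded_middle_informative as [C|N]; [|contradiction].
  unfold gain, tilt_step; cbn [bet_M bet_V bet_W]. unfold Rdiv. ring.
Qed.

(** For |y| <= b/400 the sold polynomial loses at most 1/16 of the base. For larger |y|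
    its loss is of order (y/b)^2, which the tickets repay since h(y)/h(b) is at
    least of that order. *)
Lemma short_gain_lower s k A f x : sound s -> short_condition s k A f ->
  - (bk_base s / 4) <= gain h f (short_bet s k A f) x.
Proof.
  intros Hs Hc. rewrite short_gain by assumption.
  destruct Hs as [P1 [P2 P3]]. destruct Hc as [[C1 C2] [[C3 C4] [[C5 C6] [C7 [C8 C9]]]]].
  pose proof (scale_pos A C7) as Hb. pose proof (hedge_pos h Hh _ Hb) as Hhb.
  pose proof (steep_nonneg k) as Hl.
  set (b := scale A) in *. set (lam := steep k) in *. set (y := x - fc_m f).
  assert (Bk : 0 < INR (S k)) by (apply lt_0_INR; lia).
  set (D := bk_L s / (2 * INR (S k))).
  assert (HD : 0 <= D <= 1 / 2).
  { unfold D. split; [apply Rdiv_le_0_compat; lra|]. apply div_le; lra. }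
  enough (- (1 / 4) <= D * (1 - tilt_step lam f x)
     + premium * (h y / h b - fc_w f / h b)).
  { apply Rmult_le_compat_l with (r := bk_base s) in H; lra. }
  set (t := Rabs y / b). assert (Ht : 0 <= t) by (apply Rdiv_le_0_compat; [apply Rabs_pos|lra]).
  assert (Ey : lam * Rabs y <= 46 * t).
  { unfold t. replace (lam * Rabs y) with (lam * b * (Rabs y / b)) by (field; lra).
    apply Rmult_le_compat_r; assumption. }
  assert (Ey0 : 0 <= lam * Rabs y) by (apply Rmult_le_pos; [lra|apply Rabs_pos]).
  assert (Ey2 : lam ^ 2 * y ^ 2 <= (46 * t) ^ 2).
  { rewrite <- (pow2_abs y), <- Rpow_mult_distr. apply pow_incr. lra. }
  assert (Ey1 : lam * y <= lam * Rabs y) by (apply Rmult_le_compat_l; [lra|apply Rle_abs]).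
  assert (F : - (1 / 2 * (46 * t + 1058 * t ^ 2)) <= D * (1 - tilt_step lam f x)).
  { unfold tilt_step. fold y.
    replace (1 - (1 + lam * y + lam ^ 2 / 2 * (y ^ 2 - fc_v f))) with
      (- (lam * y + lam ^ 2 * y ^ 2 / 2) + lam ^ 2 * fc_v f / 2) by field.
    assert (0 <= lam ^ 2 * fc_v f / 2).
    { apply Rdiv_le_0_compat; [apply Rmult_le_pos; [apply pow2_ge_0|lra]|lra]. }
    set (X := 46 * t + 1058 * t ^ 2).
    assert (HX : lam * y + lam ^ 2 * y ^ 2 / 2 <= X) by (unfold X; lra).
    assert (HX0 : 0 <= X) by (unfold X; pose proof (pow2_ge_0 t); lra).
    apply Rle_trans with (D * - X).
    - assert (D * X <= 1 / 2 * X) by (apply Rmult_le_compat_r; lra). lra.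
    - apply Rmult_le_compat_l; lra. }
  pose proof (hedge_nonneg h Hh y) as Hy0.
  assert (Hr0 : 0 <= h y / h b) by (apply Rdiv_le_0_compat; lra).
  destruct (Rle_lt_dec t (1 / 400)) as [S|S].
  - assert (t ^ 2 <= t * (1 / 400)) by (simpl; rewrite Rmult_1_r; apply Rmult_le_compat_l; lra).
    unfold premium in *. lra.
  - assert (Hmin : t ^ 2 / 400 <= h y / h b).
    { destruct (Rle_lt_dec (Rabs y) b) as [L|L].
      - pose proof (hedge_ratio_cubic h Hh y b Hb L) as Q. fold t in Q.
        assert (t ^ 2 * (1 / 400) <= t ^ 2 * t) by (apply Rmult_le_compat_l; [apply pow2_ge_0|lra]).
        lra.
      - pose proof (hedge_ratio_quadratic h Hh y b Hb ltac:(lra)) as Q. fold t in Q.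
        pose proof (pow2_ge_0 t). lra. }
    assert (t <= 400 * t ^ 2).
    { assert (t * (1 / 400) <= t * t) by (apply Rmult_le_compat_l; lra). lra. }
    pose proof (pow2_ge_0 t). unfold premium in *. lra.
Qed.

Lemma sound_update s k A f x : sound s -> sound (short_update s k A f x).
Proof.
  intros Hs. assert (Hs' := Hs). destruct Hs as [P1 [P2 P3]]. unfold short_update.
  destruct (excluded_middle_informative (short_condition s k A f)) as [C|N].
  - pose proof (short_gain_lower s k A f x Hs' C). destruct C as [[C1 C2] [_ [[C5 C6] _]]].
    repeat split; cbn [bk_L bk_base bk_cap]; [|lra|lra].
    apply Rmult_lt_0_compat; [exact P1|]. unfold tilt_step.
    pose proof (pow2_ge_0 (steep k * (x - fc_m f) + 1)). lra.
  - repeat split; cbn [bk_L bk_base bk_cap]; [lra|lra|].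
    unfold short_bet. destruct excluded_middle_informative; [contradiction|].
    unfold gain; cbn [bet_M bet_V bet_W]. lra.
Qed.

Lemma sound_book l : sound (book_of l).
Proof.
  induction l as [|[f x] l IH]; [repeat split; simpl; lra|].
  cbn [book_of]. apply sound_update, sound_reopen, IH.
Qed.

Lemma cap_reopen s A A' : bk_cap (reopen s A A') = bk_cap s.
Proof. unfold reopen. now destruct Nat.eq_dec. Qed.

Lemma short_bet_bound s k A f : sound s ->
  Rabs (bet_M (short_bet s k A f)) <= bk_cap s /\
  Rabs (bet_V (short_bet s k A f)) <= bk_cap s /\
  Rabs (bet_W (short_bet s k A f)) <= bk_cap s.
Proof.
  intros [P1 [P2 P3]]. unfold short_bet.
  destruct excluded_middle_informative as [C|N]; cbn [bet_M bet_V bet_W].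
  2:{ rewrite Rabs_R0. repeat split; lra. }
  destruct C as [[C1 C2] [[C3 C4] [[C5 C6] [C7 [C8 C9]]]]].
  pose proof (steep_nonneg k) as Hl.
  assert (Bk : 0 < INR (S k)) by (apply lt_0_INR; lia).
  set (D := bk_L s / (2 * INR (S k))) in *.
  assert (HD : 0 <= D <= 1 / 2).
  { unfold D. split; [apply Rdiv_le_0_compat; lra|]. apply div_le; lra. }
  assert (T : forall c, Rabs c <= 1 / 2 -> Rabs (bk_base s * c) <= bk_cap s).
  { intros c Hc. rewrite Rabs_mult, (Rabs_pos_eq (bk_base s)) by lra.
    apply Rmult_le_compat_l with (r := bk_base s) in Hc; lra. }
  assert (0 <= steep k ^ 2 <= 1) by (simpl; nra).
  repeat split; apply T.
  - rewrite Rabs_Ropp, Rabs_pos_eq by nra. nra.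
  - rewrite Rabs_Ropp, Rabs_pos_eq by nra. nra.
  - unfold premium in *. rewrite Rabs_pos_eq by (apply Rdiv_le_0_compat; lra).
    apply div_le; lra.
Qed.

Program Definition lower_martingale : martingale h := {|
  val l := bk_cap (book_of l);
  stake l f := short_bet (reopen (book_of l) (variance l) (total_variance l f))
        (block rho (total_variance l f)) (total_variance l f) f |}.
Next Obligation. now rewrite cap_reopen. Qed.
Next Obligation. destruct (sound_book l) as [_ [H1 H2]]. lra. Qed.
Next Obligation.
  rewrite <- (cap_reopen (book_of l) (variance l) (total_variance l f)).
  apply short_bet_bound, sound_reopen, sound_book.
Qed.

End Short.

(** A block ends at Q and is entered at As <= Q/r^2. Let S be the sum of deviations: Ss
    and Sn are its values at the variances As and An. Put lambda = 32
    tilt Q. The logarithm of the process sold short at An is about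
    lambda (Sn - Ss) - lambda^2 (An - As)/2. *)
Section Exponents.
Context (eps r Q As An Ss Sn : R) (Heps : 0 < eps <= 1) (Hr : 384 / eps <= r) (HAs : exp (exp 1) <= As)
  (HAsQ : As <= Q / r ^ 2) (HAsn : As <= An) (HAnQ : An <= Q)
  (HSs : - (2 * sqrt (2 * As * ln (ln As))) <= Ss)
  (HSn : Sn <= (1 - eps) * sqrt (2 * An * ln (ln An))).

Let lb := ln (ln Q).
Let g := sqrt (2 * lb).
Let q := sqrt Q.
Let a := sqrt As.

Lemma exponent_setup : 384 <= r /\ 192 / r <= eps / 2 /\ 0 < q /\ 1 <= lb /\ g ^ 2 = 2 * lb /\
  0 < g /\ q ^ 2 = Q /\ 0 <= a <= q / r /\ tilt Q = g / q /\ - (2 * (g * a)) <= Ss /\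
  Sn <= (1 - eps) * (g * sqrt An).
Proof.
  pose proof (exp_pos (exp 1)) as E0.
  assert (R1 : 384 <= r).
  { apply Rle_trans with (2 := Hr). apply le_div; [lra|]. nra. }
  assert (HQ : exp (exp 1) <= Q) by lra.
  assert (Hlb : 1 <= lb) by (apply lnln_ge_1, HQ).
  assert (Hq : 0 < q) by (apply sqrt_lt_R0; lra).
  assert (Hg : 0 < g) by (apply sqrt_lt_R0; lra).
  assert (Low : forall A, exp (exp 1) <= A -> A <= Q -> sqrt (2 * A * ln (ln A)) <= g * sqrt A).
  { intros A H1 H2. unfold g. rewrite <- sqrt_mult_alt by lra. apply sqrt_le_1_alt.
    pose proof (lnln_mono A Q H1 H2) as M. fold lb in M. nra. }
  repeat split; try assumption; try lra.
  - apply div_le; [lra|]. apply (le_mult_of_div_le _ _ _ (proj1 Heps)) in Hr. lra.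
  - apply pow2_sqrt. lra.
  - apply pow2_sqrt. lra.
  - apply sqrt_pos.
  - unfold a, q. rewrite <- (sqrt_pow2 r) by lra. rewrite <- sqrt_div_alt by nra.
    apply sqrt_le_1_alt. exact HAsQ.
  - unfold tilt. apply sqrt_div_alt. lra.
  - apply Rle_trans with (2 := HSs). pose proof (Low As HAs ltac:(lra)) as L. fold a in L. lra.
  - apply Rle_trans with (1 := HSn). apply Rmult_le_compat_l; [lra|]. apply Low; lra.
Qed.

(** With g = sqrt (2 lnln Q) and x = lambda sqrt (An - As), the increment of S
    contributes at most (1-eps) g x, and (1-eps) g x - x^2/2 <= (1-eps)^2 g^2/2 whatever
    the tilt. The start of the block contributes at most 192 lnln Q / r. *)
Lemma exponent_within_block :
  32 * tilt Q * (Sn - Ss) - (32 * tilt Q) ^ 2 * (An - As) / 2 <= (1 - eps / 2) * ln (ln Q).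
Proof.
  destruct exponent_setup as [R1 [R2 [Hq [Hlb [Eg [Hg [Eq [Ha [Et [HS1 HS2]]]]]]]]]].
  fold lb. rewrite Et. set (d := sqrt (An - As)).
  assert (Ed : d ^ 2 = An - As) by (apply pow2_sqrt; lra).
  assert (Hd : 0 <= d) by apply sqrt_pos.
  assert (Hs : sqrt An <= a + d).
  { replace An with (As + (An - As)) by ring. unfold a, d.
    pose proof (exp_pos (exp 1)).
    rewrite <- (sqrt_pow2 (sqrt As + sqrt (An - As))) by (fold a d; lra).
    apply sqrt_le_1_alt. fold a d. assert (Ea : a ^ 2 = As) by (apply pow2_sqrt; lra). nra. }
  assert (HD : Sn - Ss <= g * ((1 - eps) * d + 3 * a)).
  { assert ((1 - eps) * (g * sqrt An) <= (1 - eps) * (g * (a + d))).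
    { apply Rmult_le_compat_l; [lra|]. apply Rmult_le_compat_l; lra. }
    assert (0 <= eps * (g * a)) by (apply Rmult_le_pos; [lra|apply Rmult_le_pos; lra]).
    lra. }
  set (x := 32 * (g / q) * d).
  assert (Hgq : 0 < 32 * (g / q)) by (apply Rmult_lt_0_compat; [lra|apply Rdiv_lt_0_compat; lra]).
  apply Rle_trans with (32 * (g / q) * (g * ((1 - eps) * d + 3 * a)) - x ^ 2 / 2).
  { replace (x ^ 2) with ((32 * (g / q)) ^ 2 * (An - As))
      by (unfold x; rewrite <- Ed; ring).
    apply Rmult_le_compat_l with (r := 32 * (g / q)) in HD; lra. }
  assert (E1 : 32 * (g / q) * (g * ((1 - eps) * d + 3 * a)) = (1 - eps) * g * x + 96 * g ^ 2 * (a / q)).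
  { unfold x. field. lra. }
  rewrite E1, Eg.
  assert (Haq : a / q <= 1 / r).
  { apply div_le; [lra|]. replace (1 / r * q) with (q / r) by (field; lra). lra. }
  assert (E2 : (1 - eps) * g * x - x ^ 2 / 2 <= (1 - eps) ^ 2 * lb).
  { pose proof (pow2_ge_0 ((1 - eps) * g - x)).
    assert ((1 - eps) ^ 2 * g ^ 2 = (1 - eps) ^ 2 * (2 * lb)) by now rewrite Eg. lra. }
  assert (E3 : 96 * (2 * lb) * (a / q) <= eps / 2 * lb).
  { apply Rle_trans with (96 * (2 * lb) * (1 / r)); [apply Rmult_le_compat_l; lra|].
    replace (96 * (2 * lb) * (1 / r)) with (192 / r * lb) by (field; lra).
    apply Rmult_le_compat_r; lra. }
  assert (E4 : (1 - eps) ^ 2 * lb <= (1 - eps) * lb).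
  { apply Rmult_le_compat_r; [lra|]. nra. }
  lra.
Qed.

(** At the end of the block the increment of S is at most 2 g sqrt Q, contributing
    128 lnln Q, whereas An - As >= Q/4 makes the quadratic term at least
    256 lnln Q. *)
Lemma exponent_end_of_block : Q / 2 <= An ->
  32 * tilt Q * (Sn - Ss) - (32 * tilt Q) ^ 2 * (An - As) / 2 <= - (128 * ln (ln Q)).
Proof.
  intros HAn.
  destruct exponent_setup as [R1 [R2 [Hq [Hlb [Eg [Hg [Eq [Ha [Et [HS1 HS2]]]]]]]]]].
  fold lb. rewrite Et.
  assert (Haq : a <= q / 2).
  { apply Rle_trans with (1 := proj2 Ha). unfold Rdiv. apply Rmult_le_compat_l; [lra|].
    apply Rinv_le_contravar; lra. }
  assert (HsAn : sqrt An <= q) by (apply sqrt_le_1_alt; lra).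
  assert (HAs4 : As <= Q / 4).
  { replace As with (a ^ 2) by (apply pow2_sqrt; pose proof (exp_pos (exp 1)); lra).
    replace (Q / 4) with ((q / 2) ^ 2) by (rewrite <- Eq; field).
    apply pow_incr. lra. }
  assert (HD : Sn - Ss <= 2 * g * q).
  { assert ((1 - eps) * (g * sqrt An) <= 1 * (g * q)).
    { apply Rmult_le_compat; [lra| |lra|apply Rmult_le_compat_l; lra].
      apply Rmult_le_pos; [lra|apply sqrt_pos]. }
    assert (g * a <= g * (q / 2)) by (apply Rmult_le_compat_l; lra). lra. }
  assert (Hgq : 0 < 32 * (g / q)) by (apply Rmult_lt_0_compat; [lra|apply Rdiv_lt_0_compat; lra]).
  apply Rmult_le_compat_l with (r := 32 * (g / q)) in HD; [|lra].
  replace (32 * (g / q) * (2 * g * q)) with (64 * g ^ 2) in HD by (field; lra).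
  assert (X : (32 * (g / q)) ^ 2 * (Q / 4) / 2 <= (32 * (g / q)) ^ 2 * (An - As) / 2).
  { apply Rmult_le_compat_r; [lra|]. apply Rmult_le_compat_l; [apply pow2_ge_0|lra]. }
  replace ((32 * (g / q)) ^ 2 * (Q / 4) / 2) with (128 * g ^ 2) in X by (rewrite <- Eq; field; lra).
  lra.
Qed.

End Exponents.

(** * The lower bound along a path *)

Lemma variance_past f x n : variance (past f x n) = var_sum f n.
Proof.
  pose proof (total_variance_past f x n) as E. unfold total_variance, var_sum in *.
  cbn [psum] in E. lra.
Qed.

(** A path on which S stays below (1-eps) sqrt (2 A lnln A) from round N on. The last
    hypothesis says that the blocks visited after N have a large index. The
    tolerance 10^(-8) stays small when multiplied by the factors 13 * 46^3 and [premium]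
    with which the errors enter. *)
Section ShortPath.
Context (h : R -> R) (Hh : hedge h) (f : nat -> forecast) (x : nat -> R)
  (R0 : regular_path h f x) (eps r : R) (Heps : 0 < eps <= 1) (Hr : 384 / eps <= r)
  (N : nat) (T : forall n, (N <= n)%nat -> tame h f x (/ 100000000) n)
  (Slow : forall n, (N <= n)%nat ->
     - (2 * sqrt (2 * var_sum f n * ln (ln (var_sum f n)))) <= dev_sum f x n)
  (Shigh : forall n, (N <= n)%nat ->
     dev_sum f x n <= (1 - eps) * sqrt (2 * var_sum f n * ln (ln (var_sum f n))))
  (Hk : forall n, (N <= n)%nat ->
     2 + ln (ln (r ^ 2)) <= eps / 2 *
       (ln (INR (S (block (r ^ 2) (var_sum f n)))) + ln (ln (r ^ 2)))).

Let rho := r ^ 2.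
Let E := psum (error h f x).
Let kn n := block rho (var_sum f (S n)).
Let state n := reopen rho (book_of h rho (past f x n)) (var_sum f n) (var_sum f (S n)).

Lemma book_of_past_S n : book_of h rho (past f x (S n)) =
  short_update h rho (state n) (kn n) (var_sum f (S n)) (f n) (x n).
Proof.
  unfold state, kn. cbn [past book_of]. now rewrite variance_past, total_variance_past.
Qed.

Lemma r_large : 384 <= r.
Proof. apply Rle_trans with (2 := Hr). apply le_div; nra. Qed.

Lemma rho_large : 4 <= rho.
Proof. pose proof r_large. unfold rho. nra. Qed.

Lemma var_mono i j : (i <= j)%nat -> var_sum f i <= var_sum f j.
Proof. apply psum_mono. intro k. apply (rp_legal _ _ _ R0 k). Qed.

Lemma var_large n : (N <= n)%nat -> exp (exp 1) <= var_sum f n.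
Proof. intro Hn. apply (tame_A _ _ _ _ _ (T n Hn)). Qed.

Lemma var_gt_1 n : (N <= n)%nat -> 1 <= var_sum f n.
Proof.
  intro Hn. pose proof (var_large n Hn). pose proof (exp_ineq1 (exp 1)). pose proof (exp_pos 1). lra.
Qed.

Lemma block_bounds n : (N <= n)%nat -> rho ^ kn n <= var_sum f (S n) < rho ^ S (kn n).
Proof.
  intro Hn. apply block_spec; [pose proof rho_large; lra|]. apply var_gt_1. lia.
Qed.

(** v_n is o(b_n^2), so A_n cannot jump over a block nor far beyond the end of one. *)
Lemma var_doubling n : (N <= n)%nat -> var_sum f (S n) <= 2 * var_sum f n.
Proof.
  intro Hn. pose proof (tame_v _ _ _ _ _ (T n Hn)) as Hv.
  destruct (rp_legal _ _ _ R0 n) as [Hv0 _].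
  pose proof (var_large (S n) ltac:(lia)) as HA. pose proof (lnln_ge_1 _ HA) as Hl.
  pose proof (exp_pos (exp 1)).
  set (A := var_sum f (S n)) in *.
  assert (Hsc : scale A ^ 2 <= A).
  { unfold scale. rewrite pow2_sqrt by (apply Rdiv_le_0_compat; lra).
    apply div_le; [lra|]. nra. }
  assert (V : fc_v (f n) <= (/ 100000000 * scale A) ^ 2).
  { rewrite <- (pow2_sqrt (fc_v (f n))) by lra. apply pow_incr. split; [apply sqrt_pos|exact Hv]. }
  rewrite Rpow_mult_distr in V.
  assert (EA : A = var_sum f n + fc_v (f n)) by reflexivity.
  lra.
Qed.

Lemma lnln_block k : ln (ln (rho ^ S k)) = ln (INR (S k)) + ln (ln rho).
Proof. apply ln_ln_pow; [pose proof rho_large; lra|lia]. Qed.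

Let exponent s n k := steep rho k * (dev_sum f x n - dev_sum f x s)
  - steep rho k ^ 2 * (var_sum f n - var_sum f s) / 2.

Let slack s n := 13 * 46 ^ 3 * (E n - E s).

Lemma error_tail s n : (N <= s)%nat -> (s <= n)%nat -> 0 <= E n - E s <= / 100000000.
Proof.
  intros Hs Hn. split.
  - enough (E s <= E n) by lra. apply psum_mono; [|exact Hn]. intro i. now apply error_nonneg.
  - apply (tame_tail _ _ _ _ _ (T s Hs) n Hn).
Qed.

(** exp ((1 - eps/2) lnln rho^(k+1)) is of order (k+1)^(1 - eps/2), which is small
    against k+1. *)
Lemma within_block_small s n k : (N <= s)%nat -> (s <= n)%nat -> (N <= n)%nat ->
  var_sum f s < rho ^ k -> k = kn n ->
  exp (exponent s n k + slack s n) <= INR (S k) / 2.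
Proof.
  intros Hs Hsn Hn HA ->. set (k := kn n) in *.
  destruct (block_bounds n Hn) as [_ B2]. fold k in B2.
  pose proof (var_mono n (S n) ltac:(lia)) as M.
  pose proof r_large as Rl.
  pose proof (exponent_within_block eps r (rho ^ S k) (var_sum f s) (var_sum f n)
    (dev_sum f x s) (dev_sum f x n) Heps Hr (var_large s Hs)) as X.
  specialize (X ltac:(apply le_div; [apply pow_lt; lra|]; fold rho; simpl; pose proof rho_large; nra)
    (var_mono s n Hsn) ltac:(lra) (Slow s Hs) (Shigh n Hn)).
  pose proof (Hk (S n) ltac:(lia)) as K. fold rho in K. fold (kn n) in K. fold k in K.
  pose proof (error_tail s n Hs Hsn) as Et.
  rewrite lnln_block in X.
  assert (P : 0 < INR (S k)) by (apply lt_0_INR; lia).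
  assert (L2 : ln 2 <= 1) by (pose proof (ln_le_pred 2); lra).
  replace (INR (S k) / 2) with (exp (ln (INR (S k)) - ln 2))
    by (unfold Rminus; rewrite exp_plus, exp_Ropp, !exp_ln by lra; reflexivity).
  apply exp_mono. unfold exponent, slack, steep. lra.
Qed.

Lemma end_of_block_small s n k : (N <= s)%nat -> (s <= n)%nat ->
  var_sum f s < rho ^ k -> rho ^ S k / 2 <= var_sum f n <= rho ^ S k ->
  exp (exponent s n k + slack s n) <= 1 / 2.
Proof.
  intros Hs Hsn HA HAn.
  pose proof r_large as Rl.
  pose proof (exponent_end_of_block eps r (rho ^ S k) (var_sum f s) (var_sum f n)
    (dev_sum f x s) (dev_sum f x n) Heps Hr (var_large s Hs)) as X.
  specialize (X ltac:(apply le_div; [apply pow_lt; lra|]; fold rho; simpl; pose proof rho_large; nra)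
    (var_mono s n Hsn) ltac:(lra) (Slow s Hs) (Shigh n ltac:(lia)) ltac:(lra)).
  pose proof (error_tail s n Hs Hsn) as Et.
  assert (1 <= ln (ln (rho ^ S k))).
  { apply lnln_ge_1. pose proof (var_large n ltac:(lia)). lra. }
  apply Rle_trans with (exp (Ropp 1)).
  - apply exp_mono. unfold exponent, slack, steep. lra.
  - rewrite exp_Ropp. pose proof exp1_gt_2. replace (1 / 2) with (/ 2) by field.
    apply Rinv_le_contravar; lra.
Qed.

Lemma steep_scale n : (N <= n)%nat -> steep rho (kn n) * scale (var_sum f (S n)) <= 46.
Proof.
  intro Hn. destruct (block_bounds n Hn) as [_ B].
  pose proof (var_large (S n) ltac:(lia)) as HA.
  pose proof (tilt_mult_scale (rho ^ S (kn n)) (var_sum f (S n)) (rho ^ S (kn n)) 1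
    ltac:(lra) ltac:(lra) ltac:(lra) HA ltac:(lra)) as X.
  assert (Y : sqrt (2 * 1) <= 46 / 32).
  { rewrite <- (sqrt_pow2 (46 / 32)) by lra. apply sqrt_le_1_alt. lra. }
  unfold steep. lra.
Qed.

Lemma trading_condition n s : (N <= n)%nat ->
  bk_base s / 2 <= bk_cap s -> bk_L s <= INR (S (kn n)) ->
  short_condition h rho s (kn n) (var_sum f (S n)) (f n).
Proof.
  intros Hn H1 H2. pose proof (T n Hn) as t. pose proof (steep_scale n Hn) as S46.
  pose proof (steep_nonneg rho (kn n)) as S0.
  pose proof (tame_scale _ _ _ _ _ t) as Hsc. pose proof (tame_hscale _ _ _ _ _ t) as Hhs.
  rewrite Rinv_inv in Hsc, Hhs.
  destruct (rp_legal _ _ _ R0 n) as [Hv _].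
  pose proof (tame_w _ _ _ _ _ t) as Hw.
  pose proof (tame_v _ _ _ _ _ t) as Hsv.
  set (b := scale (var_sum f (S n))) in *. set (lam := steep rho (kn n)) in *.
  assert (lam <= 1) by nra.
  assert (exp 1 < var_sum f (S n)).
  { pose proof (var_large (S n) ltac:(lia)). pose proof (exp_ineq1 (exp 1)). pose proof (exp_pos 1). lra. }
  unfold short_condition. fold b lam. unfold premium.
  repeat split; try assumption; try lra.
  replace (lam ^ 2 * fc_v (f n)) with ((lam * sqrt (fc_v (f n))) ^ 2)
    by (rewrite Rpow_mult_distr, pow2_sqrt by exact Hv; reflexivity).
  replace (1 / 4) with ((1 / 2) ^ 2) by field. pose proof (sqrt_pos (fc_v (f n))).
  apply pow_incr. split; [apply Rmult_le_pos; lra|].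
  apply Rle_trans with (lam * (/ 100000000 * b)); [apply Rmult_le_compat_l; lra|]. lra.
Qed.

Section Steps.
Context (n0 : nat) (Hn0 : (N <= n0)%nat)
  (Hstart : kn n0 <> block rho (var_sum f n0)).

Let K0 := bk_cap (book_of h rho (past f x n0)).

Let floor s k := K0 * (1 + (ln (INR (S k)) - ln (INR (S (kn n0)))) / 4)
  * exp (- (2 * premium * (E s - E n0))).

(** The current block began at round s. Its process L is bounded by the exponential,
    the capital is that of the short position less the errors since s, and the base
    capital has grown like the logarithm of the block index. *)
Definition short_invariant (n : nat) : Prop := exists s, (n0 <= s <= n)%nat /\
  (kn n0 <= kn n)%nat /\
  var_sum f s < rho ^ kn n /\
  bk_L (state n) <= exp (exponent s n (kn n) + slack s n) /\
  bk_base (state n) * (1 + (1 - bk_L (state n)) / (2 * INR (S (kn n))) - premium * (E n - E s))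
    <= bk_cap (state n) /\
  floor s (kn n) <= bk_base (state n).

Lemma K0_pos : 0 < K0.
Proof. apply (val_pos (lower_martingale h Hh rho)). Qed.

Lemma block_before n : (N <= n)%nat -> kn n <> block rho (var_sum f n) ->
  (block rho (var_sum f n) < kn n)%nat /\ var_sum f n < rho ^ kn n.
Proof.
  intros Hn Hne. destruct (block_bounds n Hn) as [B1 B2].
  assert (R1 : 1 < rho) by (pose proof rho_large; lra).
  destruct (block_spec rho (var_sum f n) R1 (var_gt_1 n Hn)) as [C1 C2].
  pose proof (var_mono n (S n) ltac:(lia)).
  assert (Hlt : (block rho (var_sum f n) < S (kn n))%nat) by (apply (pow_lt_inv rho); lra).
  split; [lia|]. apply Rlt_le_trans with (1 := C2). apply Rle_pow; [lra|lia].
Qed.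

Lemma invariant_start : short_invariant n0.
Proof.
  exists n0. destruct (block_before n0 Hn0 Hstart) as [_ HA].
  unfold state, reopen. destruct Nat.eq_dec as [e|_]; [exfalso; apply Hstart; now rewrite e|].
  cbn [bk_L bk_base bk_cap]. fold K0.
  assert (P : 0 < INR (S (kn n0))) by (apply lt_0_INR; lia).
  repeat split; [lia|lia|lia|exact HA| | |].
  - replace (exponent n0 n0 (kn n0) + slack n0 n0) with 0
      by (unfold exponent, slack; field). rewrite exp_0. lra.
  - right. field. lra.
  - unfold floor. rewrite !Rminus_diag, Rmult_0_r, Ropp_0, exp_0. lra.
Qed.

Lemma invariant_consequences n : (n0 <= n)%nat -> short_invariant n ->
  bk_L (state n) <= INR (S (kn n)) /\ bk_base (state n) / 2 <= bk_cap (state n).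
Proof.
  intros Hn [s [Hs [_ [HA [HL [HK _]]]]]].
  pose proof (within_block_small s n (kn n) ltac:(lia) ltac:(lia) ltac:(lia) HA eq_refl) as W.
  pose proof (error_tail s n ltac:(lia) ltac:(lia)) as Et.
  pose proof (sound_reopen rho _ (var_sum f n) (var_sum f (S n)) (sound_book h Hh rho (past f x n)))
    as [P1 [P2 P3]].
  fold (state n) in P1, P2, P3.
  assert (P : 0 < INR (S (kn n))) by (apply lt_0_INR; lia).
  split; [lra|].
  apply Rle_trans with (2 := HK). unfold Rdiv at 1. apply Rmult_le_compat_l; [lra|].
  assert (- (1 / 4) <= (1 - bk_L (state n)) / (2 * INR (S (kn n)))).
  { apply le_div; lra. }
  unfold premium. lra.
Qed.

(** Within a block the exponential bound and the capital are updated factor by factor.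
    At the end of a block L <= 1/2, so the capital is at least
    1 + 1/(4(k+1)) - d times the base, where d collects the errors; this exceeds
    (1 + 1/(4(k+1))) exp (-2d), and ln (k+2) - ln (k+1) <= 1/(k+1) turns the product of
    such factors into a logarithm. *)
Lemma invariant_step n : (n0 <= n)%nat -> short_invariant n -> short_invariant (S n).
Proof.
  intros Hn Inv. destruct (invariant_consequences n Hn Inv) as [CL CK].
  destruct Inv as [s [Hs [Hk0 [HA [HL [HK HF]]]]]].
  assert (HnN : (N <= n)%nat) by lia.
  pose proof (trading_condition n (state n) HnN CK CL) as Cond.
  pose proof (sound_reopen rho _ (var_sum f n) (var_sum f (S n)) (sound_book h Hh rho (past f x n)))
    as Snd. fold (state n) in Snd.
  pose proof (short_gain h rho (state n) (kn n) (var_sum f (S n)) (f n) (x n) Cond) as G.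
  destruct Snd as [P1 [P2 P3]].
  pose proof (book_of_past_S n) as EB. unfold short_update in EB. rewrite G in EB.
  destruct (excluded_middle_informative _) as [_|NC]; [|contradiction].
  clear G. set (k := kn n) in *. set (L := bk_L (state n)) in *. set (B := bk_base (state n)) in *.
  set (K := bk_cap (state n)) in *.
  assert (P : 0 < INR (S k)) by (apply lt_0_INR; lia).
  pose proof (error_tail s n ltac:(lia) ltac:(lia)) as Et.
  pose proof (error_tail s (S n) ltac:(lia) ltac:(lia)) as Et'.
  pose proof (error_tail n (S n) ltac:(lia) ltac:(lia)) as Et1.
  pose proof (tilt_factor_bounds h Hh f x (/ 100000000) n (steep rho k) 46 R0 (T n HnN)) as F.
  rewrite Rabs_pos_eq in F by apply steep_nonneg.
  specialize (F (steep_scale n HnN) ltac:(lra) ltac:(lra)). destruct F as [F1 F2].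
  pose proof (exp_pos (steep rho k * dev f x n - steep rho k ^ 2 * fc_v (f n) / 2 -
       13 * 46 ^ 3 * error h f x n)) as F0.
  set (fac := tilt_step (steep rho k) (f n) (x n)) in *.
  change (1 + steep rho k * dev f x n + steep rho k ^ 2 / 2 * (dev f x n ^ 2 - fc_v (f n)))
    with fac in F1, F2.
  assert (HL' : L * fac <= exp (exponent s (S n) k + slack s (S n))).
  { replace (exponent s (S n) k + slack s (S n)) with ((exponent s n k + slack s n) +
      (steep rho k * dev f x n - steep rho k ^ 2 * fc_v (f n) / 2 + 13 * 46 ^ 3 * error h f x n)).
    2:{ unfold exponent, slack, E, dev_sum, var_sum. cbn [psum]. field. }
    rewrite exp_plus. apply Rmult_le_compat; [lra|lra|exact HL|exact F2]. }
  set (K' := K + B * (L / (2 * INR (S k)) * (1 - fac) +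
        premium * (h (x n - fc_m (f n)) / h (scale (var_sum f (S n))) -
                   fc_w (f n) / h (scale (var_sum f (S n)))))) in *.
  assert (HK' : B * (1 + (1 - L * fac) / (2 * INR (S k)) - premium * (E (S n) - E s)) <= K').
  { pose proof (tame_gain _ _ _ _ _ (T n HnN)) as Tg. unfold dev in Tg.
    set (D := h (x n - fc_m (f n)) / h (scale (var_sum f (S n))) -
                   fc_w (f n) / h (scale (var_sum f (S n)))) in *.
    assert (EE : E (S n) = E n + error h f x n) by reflexivity.
    apply Rle_trans with (B * (1 + (1 - L) / (2 * INR (S k)) - premium * (E n - E s))
        + B * (L / (2 * INR (S k)) * (1 - fac) + premium * D)).
    - rewrite <- Rmult_plus_distr_l. apply Rmult_le_compat_l; [lra|].
      replace ((1 - L * fac) / (2 * INR (S k))) with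
        ((1 - L) / (2 * INR (S k)) + L / (2 * INR (S k)) * (1 - fac)) by (field; lra).
      unfold premium. rewrite EE. lra.
    - unfold K'. lra. }
  destruct (Nat.eq_dec (kn (S n)) k) as [Same|New].
  - exists s.
    assert (ES : state (S n) = Book (L * fac) B K').
    { unfold state. rewrite EB. unfold reopen. fold (kn n). fold (kn (S n)).
      destruct Nat.eq_dec as [_|Ne]; [reflexivity|]. exfalso. apply Ne. now rewrite Same. }
    rewrite ES, Same. cbn [bk_L bk_base bk_cap].
    repeat split; [lia|lia|exact Hk0|exact HA|exact HL'|exact HK'|exact HF].
  - destruct (block_before (S n) ltac:(lia)) as [Blt BA]; [fold (kn n); fold k; exact New|].
    fold (kn n) in Blt. fold k in Blt.
    destruct (block_bounds n HnN) as [B1 B2]. fold k in B1, B2.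
    destruct (block_bounds (S n) ltac:(lia)) as [C1 C2].
    pose proof (var_doubling (S n) ltac:(lia)) as Db.
    pose proof rho_large as Rl.
    assert (Ek : kn (S n) = S k).
    { assert ((kn (S n) < S (S k))%nat); [|lia]. apply (pow_lt_inv rho); [lra|].
      apply Rle_lt_trans with (1 := C1). apply Rle_lt_trans with (1 := Db).
      replace (rho ^ S (S k)) with (rho * rho ^ S k) by reflexivity.
      assert (0 < rho ^ S k) by (apply pow_lt; lra). nra. }
    assert (Hend : rho ^ S k / 2 <= var_sum f (S n) <= rho ^ S k).
    { rewrite Ek in C1. lra. }
    pose proof (end_of_block_small s (S n) k ltac:(lia) ltac:(lia) HA Hend) as Sm.
    assert (ES : state (S n) = Book 1 K' K').
    { unfold state. rewrite EB. unfold reopen. fold (kn n). fold (kn (S n)).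
      destruct Nat.eq_dec as [e|_]; [|reflexivity]. exfalso. apply New. now rewrite <- e. }
    exists (S n). rewrite ES. cbn [bk_L bk_base bk_cap].
    assert (HF' : floor (S n) (S k) <= K').
    { apply Rle_trans with (2 := HK').
      set (d := premium * (E (S n) - E s)) in *.
      assert (Hd : 0 <= d <= 1 / 2) by (unfold d, premium; lra).
      assert (Hg : / (4 * INR (S k)) <= (1 - L * fac) / (2 * INR (S k))).
      { apply le_div; [lra|]. replace (/ (4 * INR (S k)) * (2 * INR (S k))) with (1 / 2) by (field; lra). lra. }
      assert (Hi : 0 < / (4 * INR (S k))) by (apply Rinv_0_lt_compat; lra).
      apply Rle_trans with (B * ((1 + / (4 * INR (S k))) * exp (- (2 * d)))).
      2:{ apply Rmult_le_compat_l; [lra|].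
          apply Rle_trans with ((1 + / (4 * INR (S k))) * (1 - d)).
          - apply Rmult_le_compat_l; [lra|]. apply exp_le_one_minus_double. exact Hd.
          - assert (0 <= / (4 * INR (S k)) * d) by (apply Rmult_le_pos; lra). lra. }
      apply Rle_trans with (floor s k * ((1 + / (4 * INR (S k))) * exp (- (2 * d)))).
      2:{ apply Rmult_le_compat_r; [|exact HF]. apply Rmult_le_pos; [lra|left; apply exp_pos]. }
      unfold floor. pose proof K0_pos as KP.
      replace (- (2 * premium * (E (S n) - E n0))) with
        (- (2 * premium * (E s - E n0)) + - (2 * d)) by (unfold d; ring).
      rewrite exp_plus.
      set (e1 := exp (- (2 * premium * (E s - E n0)))). set (e2 := exp (- (2 * d))).
      assert (0 < e1 * e2) by (apply Rmult_lt_0_compat; apply exp_pos).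
      set (m := (ln (INR (S k)) - ln (INR (S (kn n0)))) / 4).
      assert (Hm : 0 <= m).
      { unfold m. enough (ln (INR (S (kn n0))) <= ln (INR (S k))) by lra.
        apply ln_mono; [apply lt_0_INR; lia|apply le_INR; lia]. }
      assert (Hln : ln (INR (S (S k))) - ln (INR (S k)) <= / INR (S k)).
      { rewrite <- ln_div; [|apply lt_0_INR; lia|exact P].
        apply Rle_trans with (INR (S (S k)) / INR (S k) - 1).
        - apply ln_le_pred. apply Rdiv_lt_0_compat; [apply lt_0_INR; lia|exact P].
        - rewrite (S_INR (S k)). right. field. lra. }
      assert (Ei : / (4 * INR (S k)) = / INR (S k) / 4) by (field; lra).
      replace (K0 * (1 + m) * e1 * ((1 + / (4 * INR (S k))) * e2)) with
        (K0 * ((1 + m) * (1 + / (4 * INR (S k)))) * (e1 * e2)) by ring.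
      rewrite <- (Rmult_assoc _ e1 e2). rewrite (Rmult_assoc _ e1 e2).
      apply Rmult_le_compat_r; [lra|]. apply Rmult_le_compat_l; [lra|].
      assert (0 <= m * / (4 * INR (S k))) by (apply Rmult_le_pos; lra).
      unfold m in *. lra. }
    rewrite Ek. repeat split; [lia|lia|lia|rewrite <- Ek; exact BA| | |exact HF'].
    + unfold exponent, slack. rewrite !Rminus_diag, !Rmult_0_r. unfold Rdiv.
      rewrite Rmult_0_l, Rminus_0_r, Rplus_0_r, exp_0. lra.
    + rewrite !Rminus_diag, !Rmult_0_r. unfold Rdiv. rewrite Rmult_0_l. lra.
Qed.

Lemma lower_martingale_floor n : (n0 <= n)%nat ->
  K0 / 4 * (1 + (ln (INR (S (kn n))) - ln (INR (S (kn n0)))) / 4)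
    <= val (lower_martingale h Hh rho) (past f x n).
Proof.
  intro Hn. assert (Inv : short_invariant n).
  { induction Hn as [|n Hn IH]; [apply invariant_start|apply invariant_step; assumption]. }
  destruct (invariant_consequences n Hn Inv) as [_ CK].
  destruct Inv as [s [Hs [Hkk [_ [_ [_ HF]]]]]].
  pose proof (error_tail n0 s ltac:(lia) ltac:(lia)) as Et.
  unfold state in CK at 2. rewrite cap_reopen in CK.
  change (val (lower_martingale h Hh rho) (past f x n)) with (bk_cap (book_of h rho (past f x n))).
  apply Rle_trans with (2 := CK). apply Rle_trans with (floor s (kn n) / 2); [|lra].
  unfold floor. pose proof K0_pos.
  set (m := (ln (INR (S (kn n))) - ln (INR (S (kn n0)))) / 4).
  assert (Hm : 0 <= m).
  { unfold m. enough (ln (INR (S (kn n0))) <= ln (INR (S (kn n)))) by lra.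
    apply ln_mono; [apply lt_0_INR; lia|apply le_INR; lia]. }
  assert (1 / 2 <= exp (- (2 * premium * (E s - E n0)))).
  { apply Rle_trans with (2 := exp_ineq1_le _). unfold premium. lra. }
  assert (0 <= K0 * (1 + m)) by (apply Rmult_le_pos; lra).
  apply Rmult_le_compat_l with (r := K0 * (1 + m)) in H0; [|lra]. lra.
Qed.

End Steps.
End ShortPath.

Section Lower.
Context (h : R -> R) (Hh : hedge h).

(** * The law of the iterated logarithm *)

Lemma block_changes f x rho N : regular_path h f x -> 1 < rho ->
  exists n, (N <= n)%nat /\ block rho (var_sum f (S n)) <> block rho (var_sum f n).
Proof.
  intros R Hr. apply NNPP. intro No.
  assert (Hc : forall j, block rho (var_sum f (j + N)) = block rho (var_sum f N)).
  { induction j as [|j IH]; [reflexivity|]. rewrite <- IH. apply NNPP. intro Ne.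
    apply No. exists (j + N)%nat. split; [lia|exact Ne]. }
  destruct (eventually_block h f x rho (S (block rho (var_sum f N))) R Hr) as [M HM].
  destruct (HM (M + N)%nat ltac:(lia)) as [_ B]. rewrite Hc in B. lia.
Qed.

(** If S stayed below (1-eps) sqrt (2 A lnln A), the short seller would become
    infinitely rich, as the logarithm of the block index is unbounded. *)
Lemma lower_bound f x C C' eps r :
  regular_path h f x -> 0 < eps <= 1 -> 384 / eps <= r ->
  (forall n, psum (h_term h f x) n <= C') ->
  (forall n, val (lower_martingale h Hh (r ^ 2)) (past f x n) <= C) ->
  (exists N, forall n, (N <= n)%nat ->
     - (2 * sqrt (2 * var_sum f n * ln (ln (var_sum f n)))) <= dev_sum f x n) ->
  ~ exists N, forall n, (N <= n)%nat ->
     dev_sum f x n <= (1 - eps) * sqrt (2 * var_sum f n * ln (ln (var_sum f n))).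
Proof.
  intros R Heps Hr HC' HC [N1 Slow] [N2 Shigh].
  destruct (eventually_tame h Hh f x C' (/ 100000000) R HC' ltac:(lra)) as [N3 T].
  assert (Rl : 384 <= r) by (apply Rle_trans with (2 := Hr); apply le_div; nra).
  assert (Hrho : 1 < r ^ 2) by nra.
  set (rho := r ^ 2) in *.
  destruct (INR_unbounded (exp ((2 + ln (ln rho)) * 2 / eps - ln (ln rho)))) as [k1 Hk1].
  destruct (eventually_block h f x rho k1 R Hrho) as [N4 HN4].
  set (N := (N1 + N2 + N3 + N4)%nat).
  assert (Hk : forall n, (N <= n)%nat -> 2 + ln (ln rho) <= eps / 2 *
       (ln (INR (S (block rho (var_sum f n)))) + ln (ln rho))).
  { intros n Hn. destruct (HN4 n ltac:(lia)) as [_ HB].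
    assert (Hx : (2 + ln (ln rho)) * 2 / eps - ln (ln rho) <= ln (INR (S (block rho (var_sum f n))))).
    { rewrite <- (ln_exp ((2 + ln (ln rho)) * 2 / eps - ln (ln rho))).
      apply ln_mono; [apply exp_pos|]. left. apply Rlt_le_trans with (1 := Hk1). apply le_INR. lia. }
    apply Rle_trans with (eps / 2 * ((2 + ln (ln rho)) * 2 / eps)).
    - right. field. lra.
    - apply Rmult_le_compat_l; lra. }
  destruct (block_changes f x rho N R Hrho) as [n0 [Hn0 Hst]].
  pose proof (lower_martingale_floor h Hh f x R eps r Heps Hr N
    (fun n Hn => T n ltac:(lia)) (fun n Hn => Slow n ltac:(lia)) (fun n Hn => Shigh n ltac:(lia))
    Hk n0 Hn0 Hst) as Fl.
  fold rho in Fl.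
  set (K0 := bk_cap (book_of h rho (past f x n0))) in *.
  assert (KP : 0 < K0) by apply (val_pos (lower_martingale h Hh rho)).
  set (c0 := ln (INR (S (block rho (var_sum f (S n0)))))) in *.
  destruct (INR_unbounded (exp (4 * (4 * C / K0) + c0))) as [k2 Hk2].
  destruct (eventually_block h f x rho k2 R Hrho) as [N5 HN5].
  destruct (HN5 (S (N5 + n0)) ltac:(lia)) as [_ HB].
  specialize (Fl (N5 + n0)%nat ltac:(lia)). specialize (HC (N5 + n0)%nat).
  set (k := block rho (var_sum f (S (N5 + n0)))) in *.
  assert (Hx : 4 * (4 * C / K0) + c0 <= ln (INR (S k))).
  { rewrite <- (ln_exp (4 * (4 * C / K0) + c0)).
    apply ln_mono; [apply exp_pos|]. left. apply Rlt_le_trans with (1 := Hk2). apply le_INR. lia. }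
  assert (K0 / 4 * (1 + 4 * C / K0) <= C).
  { apply Rle_trans with (2 := HC). apply Rle_trans with (2 := Fl).
    apply Rmult_le_compat_l; lra. }
  replace (K0 / 4 * (1 + 4 * C / K0)) with (K0 / 4 + C) in H by (field; lra). lra.
Qed.

Definition tolerance (j : nat) : R := / INR (S j).

Lemma tolerance_pos j : 0 < tolerance j.
Proof. apply Rinv_0_lt_compat, lt_0_INR. lia. Qed.

Lemma tolerance_le_1 j : tolerance j <= 1.
Proof.
  unfold tolerance. rewrite <- Rinv_1. apply Rinv_le_contravar; [lra|].
  change 1 with (INR 1). apply le_INR. lia.
Qed.

(** One sequence listing the hedge, the upper bound for y and for -y at tolerances
    1/(j+1), and the lower bound with rho = j^2. *)
Definition component (i : nat) : martingale h :=
  let j := Nat.div i 4 in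
  match Nat.modulo i 4 with
  | 0%nat => hedge_martingale h Hh
  | 1%nat => upper_martingale h (tolerance j) (tolerance_pos j) 1
  | 2%nat => upper_martingale h (tolerance j) (tolerance_pos j) (-1)
  | _ => lower_martingale h Hh (INR j ^ 2)
  end.

Lemma component_at j r : (r < 4)%nat -> component (4 * j + r) =
  match r with
  | 0%nat => hedge_martingale h Hh
  | 1%nat => upper_martingale h (tolerance j) (tolerance_pos j) 1
  | 2%nat => upper_martingale h (tolerance j) (tolerance_pos j) (-1)
  | _ => lower_martingale h Hh (INR j ^ 2)
  end.
Proof.
  intros Hr. unfold component.
  replace (Nat.div (4 * j + r) 4) with j by (apply Nat.div_unique with r; lia).
  replace (Nat.modulo (4 * j + r) 4) with r by (apply Nat.mod_unique with j; lia).
  reflexivity.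
Qed.

Definition lil_martingale : martingale h :=
  mixture (telescope_weight 1) (fun k => telescope_weight_pos 1 k Rlt_0_1)
    (telescope_weight_sum 1 Rlt_0_1) component.

Lemma component_bounded f x C i :
  (forall n, val lil_martingale (past f x n) <= C) ->
  exists D, forall n, val (component i) (past f x n) <= D.
Proof.
  intros HC. exists (C / telescope_weight 1 i). intro n.
  eapply Rle_trans; [apply (component_le_mixture _ (fun k => telescope_weight_pos 1 k Rlt_0_1)
    (telescope_weight_sum 1 Rlt_0_1) component)|].
  apply Rmult_le_compat_r; [|apply HC].
  left. apply Rinv_0_lt_compat, telescope_weight_pos. lra.
Qed.

Lemma lil_ratio_dev_sum f x n : lil_ratio f x n =
  dev_sum f x (S n) / sqrt (2 * var_sum f (S n) * ln (ln (var_sum f (S n)))).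
Proof.
  unfold lil_ratio, S_seq. rewrite A_seq_var_sum, !sum_f_R0_psum. f_equal.
  unfold dev_sum. induction (S n) as [|k IH]; simpl; [ring|]. unfold dev at 2. lra.
Qed.

(** The lower bound needs the upper bound for -y with tolerance 1, and a j that is large
    against the given precision. *)
Lemma lil_of_bounded_mixture f x C : regular_path h f x ->
  (forall n, val lil_martingale (past f x n) <= C) ->
  is_LimSup_seq (lil_ratio f x) (Finite 1).
Proof.
  intros R HC.
  assert (HB := fun i => component_bounded f x C i HC).
  destruct (HB (4 * 0 + 0)%nat) as [D0 H0]. rewrite component_at in H0 by lia.
  destruct (hedge_forces_summability h Hh f x D0 R H0) as [C' HC'].
  destruct (eventually_var_sum h f x (exp (exp 1)) R) as [Ne He].
  assert (Den : forall n, (Ne <= n)%nat -> 0 < sqrt (2 * var_sum f n * ln (ln (var_sum f n)))).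
  { intros n Hn. specialize (He n Hn). pose proof (lnln_ge_1 _ He). pose proof (exp_pos (exp 1)).
    apply sqrt_lt_R0. apply Rmult_lt_0_compat; lra. }
  intro e. split.
  - intro N. apply NNPP. intro No.
    set (e' := Rmin e 1).
    assert (He' : 0 < e' <= 1).
    { split; [apply Rmin_pos; [apply cond_pos|lra]|apply Rmin_r]. }
    assert (He'' : e' <= e) by apply Rmin_l.
    destruct (INR_unbounded (384 / e')) as [j Hj].
    destruct (HB (4 * j + 3)%nat) as [D3 H3]. rewrite component_at in H3 by lia.
    destruct (HB (4 * 0 + 2)%nat) as [D2 H2]. rewrite component_at in H2 by lia.
    destruct (upper_bound h Hh f x D2 C' (tolerance 0) (tolerance_pos 0) (-1) R
      (tolerance_le_1 0) (or_intror eq_refl) HC' H2) as [N2 HN2].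
    apply (lower_bound f x D3 C' e' (INR j) R He' ltac:(lra) HC' H3).
    + exists N2. intros n Hn. specialize (HN2 n Hn).
      unfold tolerance in HN2. replace (INR 1) with 1 in HN2 by reflexivity.
      rewrite Rinv_1 in HN2. lra.
    + exists (S (N + Ne)). intros [|n] Hn; [lia|].
      apply Rnot_lt_le. intro L. apply No. exists n. split; [lia|].
      rewrite lil_ratio_dev_sum. pose proof (Den (S n) ltac:(lia)) as P.
      apply Rle_lt_trans with (1 - e'); [lra|]. apply (Rlt_div_r _ _ _ P). exact L.
  - destruct (INR_unbounded (/ e)) as [j Hj].
    assert (Ht : tolerance j < e).
    { unfold tolerance. rewrite <- (Rinv_inv e). pose proof (cond_pos e).
      apply Rinv_lt_contravar; [|rewrite S_INR; lra].
      apply Rmult_lt_0_compat; [apply Rinv_0_lt_compat; lra|apply lt_0_INR; lia]. }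
    destruct (HB (4 * j + 1)%nat) as [D1 H1]. rewrite component_at in H1 by lia.
    destruct (upper_bound h Hh f x D1 C' (tolerance j) (tolerance_pos j) 1 R
      (tolerance_le_1 j) (or_introl eq_refl) HC' H1) as [N1 HN1].
    exists (N1 + Ne)%nat. intros n Hn. rewrite lil_ratio_dev_sum.
    pose proof (Den (S n) ltac:(lia)) as P. specialize (HN1 (S n) ltac:(lia)).
    rewrite Rmult_1_l in HN1.
    apply Rle_lt_trans with (1 + tolerance j); [|lra]. apply div_le; assumption.
Qed.

End Lower.

Theorem theorem1p4 (h : R -> R)
  (h_even : forall x, h (- x) = h x)
  (h_C2 : C2 h)
  (h_0 : h 0 = 0)
  (h'_0 : Derive h 0 = 0)
  (h''_0 : Derive_n h 2 0 = 0)
  (h''_incr : strictly_increasing_nonneg (Derive_n h 2))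
  (h''_unbounded : unbounded_nonneg (Derive_n h 2))
  (h''_concave : concave_nonneg (Derive_n h 2)) :
  can_force h (fun (f : nat -> forecast) (x : nat -> R) =>
    is_lim_seq (A_seq f) p_infty /\ ex_series (w_term h f) ->
    is_LimSup_seq (lil_ratio f x) (Finite 1)).
Proof.
  pose proof (hedge_of_C2 h h_even h_C2 h_0 h'_0 h''_0 h''_incr h''_concave) as Hh.
  apply (force_of_martingale (lil_martingale h Hh)).
  intros f x Hleg Hcoh [C HC] [HA Hw].
  exact (lil_of_bounded_mixture h Hh f x C (RegularPath h f x Hleg Hcoh HA Hw) HC).
Qed.
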